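(* Let $n\ge1$ and let $\{X^u\}_{u\in\mathbb{N}^n}$ be a multi-critical, exhaustive $n$-parameter filtration of a cell complex $X$. Then, for all $q\in\mathbb{N}$, $$\operatorname{supp}\xi_0^q\subseteq\overline{\mathcal{G}(G_q)},\qquad\operatorname{supp}\xi_1^q\subseteq\mathcal{G}(R_q)\cup\mathcal{G}(G_{q+1})\cup\overline{\mathcal{G}(G_q)},\qquad\operatorname{supp}\xi_n^q\subseteq\overline{\mathcal{G}(R_q)\cup\mathcal{G}(G_{q+1})},$$ and $$\bigcup_{i=0}^n\operatorname{supp}\xi_i^q\subseteq\overline{\mathcal{G}(R_q)\cup\mathcal{G}(G_{q+1})}\cup\overline{\mathcal{G}(G_q)}.$$ Furthermore, the same containments hold if the sets $\mathcal{G}(G_q)$, $\mathcal{G}(G_{q+1})$ and $\mathcal{G}(R_q)$ are determined from $\{M^u\}_{u\in\mathbb{N}^n}$ instead of $\{X^u\}_{u\in\mathbb{N}^n}$, where $\{M^u\}_{u\in\mathbb{N}^n}$ is the $n$-parameter filtration of the Morse complex $M$ associated with any fixed discrete gradient vector field on $X$ consistent with the filtration $\{X^u\}_{u\in\mathbb{N}^n}$.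
   Context: $\mathbb{F}$ is a fixed field, $\mathbb{N}=\{0,1,\dots\}$, $e_1,\dots,e_n$ is the standard basis of $\mathbb{N}^n$, and $\preceq$ is the coordinatewise order on $\mathbb{N}^n$, with least upper bound $\vee$. A cell complex is a finite graded set $X=\bigsqcup_{q\in\mathbb{N}}X_q$ (elements of $X_q$ are $q$-cells) with an incidence function $\kappa:X\times X\to\mathbb{F}$ such that $\kappa(\tau,\sigma)\neq0$ implies $\dim\tau=\dim\sigma+1$, and $\sum_{\rho\in X}\kappa(\tau,\rho)\kappa(\rho,\sigma)=0$ for all $\tau,\sigma$. Write $\sigma<\tau$ if $\kappa(\tau,\sigma)\ne0$; the face partial order $\le$ is generated by this relation. $C_*(X)$ is the chain complex with $C_q(X)$ the $\mathbb{F}$-vector space with basis $X_q$ and $\partial_q(\tau)=\sum_{\sigma\in X_{q-1}}\kappa(\tau,\sigma)\sigma$. A subcomplex is a subset closed under passing to faces, with the restricted incidence function. $H_q$ denotes homology. An $n$-parameter filtration of $X$ is a family of subcomplexes $\{X^u\}_{u\in\mathbb{N}^n}$ with $X^u\subseteq X^v$ for $u\preceq v$; one sets $X^w=\emptyset$ if $w\notin\mathbb{N}^n$. It is exhaustive if $X=\bigcup_uX^u$. The set of entrance grades of a cell $\sigma$ is $\operatorname{ent}(\sigma)=\{u\in\mathbb{N}^n\mid\sigma\in X^u\setminus\bigcup_{j=1}^nX^{u-e_j}\}$. The filtration is one-critical if every cell has exactly one entrance grade, and multi-critical if it is not one-critical. For $q\in\mathbb{N}$: $\mathcal{G}(G_q)=\{v\in\mathbb{N}^n\mid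 v\in\operatorname{ent}(\sigma)\text{ for some }\sigma\in X_q\}$, and $\mathcal{G}(R_q)=\{w\in\mathbb{N}^n\mid w=v_0\vee v_1\text{ with }v_0\ne v_1\in\operatorname{ent}(\sigma)\text{ for some }\sigma\in X_q\}$. For $G\subseteq\mathbb{N}^n$, $\overline{G}$ is the set of least upper bounds of nonempty finite subsets of $G$. $S=\mathbb{F}[x_1,\dots,x_n]$; $V_q=\bigoplus_{u\in\mathbb{N}^n}H_q(X^u)$ is the $n$-graded $S$-module on which $x_i$ acts by the maps $H_q(X^u)\to H_q(X^{u+e_i})$ induced by inclusion. $\xi_i^q(u)=\dim_{\mathbb{F}}(\operatorname{Tor}_i^S(V_q,\mathbb{F}))^u$, where $\mathbb{F}=S/\langle x_1,\dots,x_n\rangle$; $\operatorname{supp}\xi_i^q=\{u\mid\xi_i^q(u)\neq0\}$. A discrete vector field $\mathcal{V}$ on $X$ is a set of pairs $(\sigma,\tau)\in X\times X$ with $\sigma<\tau$ such that every cell appears in at most one pair (in at most one position). It is a discrete gradient vector field if there is no sequence $(\sigma_0,\tau_0,\dots,\sigma_{r-1},\tau_{r-1},\sigma_r)$ with $r\ge1$, $(\sigma_i,\tau_i)\in\mathcal{V}$, $\sigma_{i+1}<\tau_i$, $\sigma_{i+1}\ne\sigma_i$ for all $0\le i<r$, and $\sigma_r=\sigma_0$. It is consistent with the filtration if for all $(\sigma,\tau)\in\mathcal{V}$ and all $u$, $\sigma\in X^u$ if and only if $\tau\in X^u$. $M=\bigsqcup_qM_q$ is the set of critical cells (cells in no pair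 of $\mathcal{V}$), graded by dimension, and $M^u=M\cap X^u$; the sets $\mathcal{G}(G_q)$, $\mathcal{G}(R_q)$ determined from $\{M^u\}$ are those given by the formulas above with $X_q$ replaced by $M_q$ and entrance grades taken in $\{M^u\}$. ($M$ also carries an incidence function making it a cell complex filtered by the $M^u$, but only the critical cells and their grades enter the statement.) *)

(* Defs.v *)
From HB Require Import structures.
From mathcomp Require Import all_boot all_order all_algebra.
From mathcomp Require Import mpoly.

Set Implicit Arguments.
Unset Strict Implicit.
Unset Printing Implicit Defensive.

Import GRing.Theory.
Local Open Scope ring_scope.

(* The quotient vT / U is carried by the complement U^C of U; what
   matters is that the projection vpi U is onto with kernel U. *)
Definition vquot (F : fieldType) (vT : vectType F) (U : {vspace vT})
  : vectType F := subvs_of (U^C)%VS.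

Definition vpi (F : fieldType) (vT : vectType F) (U : {vspace vT})
  : 'Hom(vT, vquot U) :=
  (linfun (vsproj (U^C)%VS) \o daddv_pi (U^C)%VS U)%VF.

Definition vrep (F : fieldType) (vT : vectType F) (U : {vspace vT})
  : 'Hom(vquot U, vT) := linfun (@vsval F vT (U^C)%VS).

Lemma vrepK (F : fieldType) (vT : vectType F) (U : {vspace vT}) :
  cancel (vrep U) (vpi U).
Proof.
move=> x; rewrite /vpi comp_lfunE lfunE /vrep lfunE /=.
by rewrite daddv_pi_id ?vsvalK ?subvsP // capvC capv_compl.
Qed.

Lemma vpi_eq0 (F : fieldType) (vT : vectType F) (U : {vspace vT}) (v : vT) :
  (vpi U v == 0) = (v \in U).
Proof.
have UC0 : (U^C :&: U = 0)%VS by rewrite capvC capv_compl.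
have piE : (vpi U v == 0) = (daddv_pi (U^C)%VS U v == 0).
  rewrite /vpi comp_lfunE lfunE /=; apply/eqP/eqP => [h|->].
    by rewrite -[LHS](@vsprojK _ _ (U^C)%VS) ?memv_pi // h linear0.
  exact: linear0.
have vD : daddv_pi (U^C)%VS U v + daddv_pi U (U^C)%VS v = v.
  by apply: daddv_pi_add => //; rewrite addvC addv_complf memvf.
rewrite piE; apply/eqP/idP => [h|vU].
  by rewrite -vD h add0r memv_pi.
have := vD; rewrite [X in _ + X]daddv_pi_id ?capv_compl //.
by move/(canRL (addrK _)); rewrite subrr.
Qed.

Lemma vquot_repB (F : fieldType) (vT : vectType F) (U : {vspace vT}) (v : vT) :
  vrep U (vpi U v) - v \in U.
Proof. by rewrite -vpi_eq0 linearB /= vrepK subrr. Qed.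

(* Z / (B :&: Z); in all uses B <= Z. *)
Definition subquot (F : fieldType) (vT : vectType F) (Z B : {vspace vT})
  : vectType F := vquot (linfun (@vsval F vT Z) @^-1: B)%VS.

(* Meaningful on vectors of Z only. *)
Definition sqclass (F : fieldType) (vT : vectType F) (Z B : {vspace vT})
  : 'Hom(vT, subquot Z B) := (vpi _ \o linfun (vsproj Z))%VF.

Definition sqrep (F : fieldType) (vT : vectType F) (Z B : {vspace vT})
  : 'Hom(subquot Z B, vT) := (linfun (@vsval F vT Z) \o vrep _)%VF.

Section Subquotient.
Variables (F : fieldType) (vT : vectType F) (Z B : {vspace vT}).

Lemma sqrepP x : sqrep Z B x \in Z.
Proof. by rewrite /sqrep comp_lfunE lfunE /= subvsP. Qed.

Lemma sqrepK : cancel (sqrep Z B) (sqclass Z B).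
Proof.
move=> x; rewrite [sqclass _ _ _]comp_lfunE [sqrep _ _ _]comp_lfunE.
rewrite [linfun _ (vrep _ x)]lfunE [linfun _ (vsval _)]lfunE /= vsvalK.
exact: vrepK.
Qed.

Lemma sqclass_eq0 z : z \in Z -> (sqclass Z B z == 0) = (z \in B).
Proof.
move=> zZ; rewrite [sqclass _ _ _]comp_lfunE vpi_eq0 -memv_preim.
by rewrite [linfun _ z]lfunE lfunE /= vsprojK.
Qed.

Lemma sqclass_repB z : z \in Z -> sqrep Z B (sqclass Z B z) - z \in B.
Proof.
move=> zZ; rewrite -sqclass_eq0 ?memvB ?sqrepP //.
by rewrite linearB /= sqrepK subrr.
Qed.

End Subquotient.

(* An n-graded module over S = F[x_1, ..., x_n], with grades in N^n: the
   homogeneous components and, for u <= v, multiplication by the monomial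
   x^(v-u) from grade u to grade v. The value of gmul u v is irrelevant
   unless u <= v. Grades are the exponents 'X_{1..n} of mpoly, for which
   (u <= v)%MM is the coordinatewise order and U_(j)%MM is e_j. *)
Record gmod (F : fieldType) (n : nat) := GMod {
  gpiece :> 'X_{1..n} -> vectType F;
  gmul : forall u v, 'Hom(gpiece u, gpiece v);
  gmul_id : forall u x, gmul u u x = x;
  gmul_comp : forall u v w, (u <= v)%MM -> (v <= w)%MM ->
    forall x, gmul v w (gmul u v x) = gmul u w x
}.
Arguments gmul {F n} V u v : rename.

(* Homogeneous S-linear maps of degree 0. *)
Record ghom (F : fieldType) (n : nat) (V W : gmod F n) := GHom {
  gfun :> forall u, 'Hom(V u, W u);
  gfunP : forall u v, (u <= v)%MM ->
    forall x, gfun v (gmul V u v x) = gmul W u v (gfun u x)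
}.

(* A graded set of generators with finitely many generators in each grade. *)
Record gens (n : nat) := Gens {
  gen :> choiceType;
  gdeg : gen -> 'X_{1..n};
  gens_upto : 'X_{1..n} -> seq gen;
  mem_gens_upto : forall u b, (b \in gens_upto u) = (gdeg b <= u)%MM
}.

Definition coef (F : fieldType) (T : choiceType) (s : seq T)
    (f : {ffun seq_sub s -> F^o}) (b : T) : F :=
  if insub b is Some c then f c else 0.

Lemma coef_val (F : fieldType) (T : choiceType) (s : seq T)
    (f : {ffun seq_sub s -> F^o}) (b : seq_sub s) : coef f (val b) = f b.
Proof. by rewrite /coef valK. Qed.

Lemma coef_out (F : fieldType) (T : choiceType) (s : seq T)
    (f : {ffun seq_sub s -> F^o}) (b : T) : b \notin s -> coef f b = 0.
Proof. by move=> bs; rewrite /coef insubN. Qed.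

Definition recoef (F : fieldType) (T : choiceType) (s t : seq T)
    (f : {ffun seq_sub s -> F^o}) : {ffun seq_sub t -> F^o} :=
  [ffun b => coef f (val b)].

Lemma recoef_is_linear (F : fieldType) (T : choiceType) (s t : seq T) :
  linear (@recoef F T s t).
Proof.
move=> a f g; apply/ffunP=> b; rewrite !ffunE /coef.
by case: insubP => [c _ _|_]; rewrite ?ffunE // scaler0 addr0.
Qed.

HB.instance Definition _ (F : fieldType) (T : choiceType) (s t : seq T) :=
  GRing.isLinear.Build F {ffun seq_sub s -> F^o} {ffun seq_sub t -> F^o} _
    (@recoef F T s t) (@recoef_is_linear F T s t).

Lemma coef_recoef (F : fieldType) (T : choiceType) (s t : seq T)
    (f : {ffun seq_sub s -> F^o}) (b : T) :
  coef (recoef t f) b = if b \in t then coef f b else 0.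
Proof.
case: ifPn => bt; last exact: coef_out.
by rewrite -[b]/(val (SeqSub bt)) coef_val ffunE.
Qed.

Section FreeModule.
Variables (F : fieldType) (n : nat) (B : gens n).

Definition free_piece (u : 'X_{1..n}) : vectType F :=
  {ffun seq_sub (gens_upto B u) -> F^o}.

Definition free_mul u v : 'Hom(free_piece u, free_piece v) :=
  linfun (@recoef F B (gens_upto B u) (gens_upto B v)).

Lemma free_mul_id u x : free_mul u u x = x.
Proof. by rewrite lfunE; apply/ffunP => b; rewrite ffunE coef_val. Qed.

Lemma free_mul_comp u v w : (u <= v)%MM -> (v <= w)%MM ->
  forall x, free_mul v w (free_mul u v x) = free_mul u w x.
Proof.
move=> uv vw x; rewrite !lfunE; apply/ffunP => b; rewrite !ffunE.
rewrite coef_recoef; case: ifPn => // bv; rewrite coef_out //.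
by apply: contra bv; rewrite !mem_gens_upto => /lepm_trans; apply.
Qed.

(* The direct sum of the S(- gdeg b), b in B: in grade u it has the basis
   x^(u - gdeg b) b, for the finitely many b with gdeg b <= u. *)
Definition free_gmod : gmod F n := GMod free_mul_id free_mul_comp.

End FreeModule.

Record free_resolution (F : fieldType) (n : nat) (V : gmod F n) := FreeRes {
  res_gens : nat -> gens n;
  res_d : forall i,
    ghom (free_gmod F (res_gens i.+1)) (free_gmod F (res_gens i));
  res_aug : ghom (free_gmod F (res_gens 0)) V;
  res_onto : forall u, limg (res_aug u) = fullv;
  res_exact0 : forall u, limg (res_d 0 u) = lker (res_aug u);
  res_exactS : forall i u, limg (res_d i.+1 u) = lker (res_d i u)
}.

(* Grade u of <x_1, ..., x_n> V. *)
Definition irr_sub (F : fieldType) (n : nat) (V : gmod F n) (u : 'X_{1..n})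
  : {vspace V u} :=
  (\sum_(j < n | (U_(j) <= u)%MM) limg (gmul V (u - U_(j))%MM u))%VS.

(* Grade u of the tensor product of V and S / <x_1, ..., x_n> over S. *)
Definition tensF (F : fieldType) (n : nat) (V : gmod F n) (u : 'X_{1..n})
  : vectType F := vquot (irr_sub V u).

Definition tensF_map (F : fieldType) (n : nat) (V W : gmod F n)
    (f : ghom V W) (u : 'X_{1..n}) : 'Hom(tensF V u, tensF W u) :=
  (vpi _ \o f u \o vrep _)%VF.

Lemma tensF_map_pi (F : fieldType) (n : nat) (V W : gmod F n)
    (f : ghom V W) (u : 'X_{1..n}) (x : V u) :
  tensF_map f u (vpi (irr_sub V u) x) = vpi (irr_sub W u) (f u x).
Proof.
rewrite [LHS]comp_lfunE [in LHS]comp_lfunE.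
apply/eqP; rewrite -subr_eq0 -!linearB vpi_eq0.
set y := _ - x; have : y \in irr_sub V u by exact: vquot_repB.
case/memv_sumP => z zP ->; rewrite linear_sum; apply: memv_sumr => j ju.
have /memv_imgP[t _ ->] := zP j ju; rewrite /= gfunP ?memv_img ?memvf //.
exact: lem_subr.
Qed.

Section Tor.
Variables (F : fieldType) (n : nat) (V : gmod F n) (P : free_resolution V).

Definition tor_cycles (i : nat) (u : 'X_{1..n})
  : {vspace tensF (free_gmod F (res_gens P i)) u} :=
  match i with
  | 0 => fullv
  | j.+1 => lker (tensF_map (res_d P j) u)
  end.

(* Grade u of the homology in degree i of the resolution P tensored with
   S / <x_1, ..., x_n>. *)
Definition tor_res (i : nat) (u : 'X_{1..n}) : vectType F :=
  subquot (tor_cycles i u) (limg (tensF_map (res_d P i) u)).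

End Tor.

(* The standard resolution: cover V by the free module on bases of all its
   homogeneous components, then repeat with the kernel. *)
Section Cover.
Variables (F : fieldType) (n : nat) (V : gmod F n).

Definition cover_gen : choiceType := {g : 'X_{1..n} & 'I_(\dim {:V g})}.

Definition cover_upto (u : 'X_{1..n}) : seq cover_gen :=
  [seq Tagged (fun g => 'I_(\dim {:V g})) k
    | g <- [seq g <- map (@bmnm n _) (enum {: 'X_{1..n < (mdeg u).+1}})
           | (g <= u)%MM],
      k <- enum 'I_(\dim {:V g})].

Lemma mem_cover_upto u (b : cover_gen) :
  (b \in cover_upto u) = (tag b <= u)%MM.
Proof.
case: b => g k /=; apply/allpairsPdep/idP.
  by case=> h [l [+ _ /(congr1 tag)/= ->]]; rewrite mem_filter => /andP[].
move=> gu; exists g, k; split; rewrite ?mem_enum //.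
have gu' : (mdeg g < (mdeg u).+1)%N.
  by rewrite ltnS -(submK gu) mdegD leq_addl.
rewrite mem_filter gu; apply/mapP; exists (BMultinom gu') => //.
by rewrite mem_enum.
Qed.

Definition cover_gens : gens n := Gens mem_cover_upto.

Definition cover_vec (u : 'X_{1..n}) (b : cover_gen) : V u :=
  gmul V (tag b) u (vbasis {:V (tag b)})`_(tagged b).

Definition cover_fun u (f : free_piece F cover_gens u) : V u :=
  \sum_b f b *: cover_vec u (val b).

Lemma cover_fun_is_linear u : linear (@cover_fun u).
Proof.
move=> a f g; rewrite /cover_fun scaler_sumr -big_split /=.
by apply: eq_bigr => b _; rewrite !ffunE scalerDl scalerA.
Qed.

HB.instance Definition _ u :=
  GRing.isLinear.Build F (free_piece F cover_gens u) (V u) _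
    (@cover_fun u) (@cover_fun_is_linear u).

Lemma cover_funE u (s : seq cover_gen) (f : free_piece F cover_gens u) :
  uniq s -> {subset cover_upto u <= s} ->
  cover_fun f = \sum_(b <- s) coef f b *: cover_vec u b.
Proof.
move=> us sub; pose E b := coef f b *: cover_vec u b.
transitivity (\sum_(b <- map val (index_enum (seq_sub (cover_upto u)))) E b).
  by rewrite big_map; apply: eq_bigr => b _; rewrite /E coef_val.
rewrite [RHS](bigID (mem (cover_upto u))) /= [X in _ + X]big1 ?addr0; last first.
  by move=> b bs; rewrite coef_out ?scale0r.
rewrite -[RHS]big_filter.
apply: perm_big; apply: uniq_perm; rewrite ?filter_uniq //.
  by rewrite map_inj_uniq ?index_enum_uniq //; exact: val_inj.
move=> b; rewrite mem_filter; apply/mapP/andP => [[c _ ->]|[/= bu _]].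
  by split; [exact: valP | apply/sub/valP].
by exists (SeqSub bu); rewrite // mem_index_enum.
Qed.

Lemma cover_fun_mul u v : (u <= v)%MM -> forall x,
  linfun (@cover_fun v) (gmul (free_gmod F cover_gens) u v x)
    = gmul V u v (linfun (@cover_fun u) x).
Proof.
move=> uv x; rewrite ![linfun _ _]lfunE /=.
set s := undup (cover_upto v).
have us : uniq s by exact: undup_uniq.
have sv : {subset cover_upto v <= s} by move=> b; rewrite mem_undup.
have su : {subset cover_upto u <= s}.
  move=> b; rewrite mem_undup !mem_cover_upto => bu; exact: lepm_trans uv.
rewrite (cover_funE _ us sv) (cover_funE _ us su) linear_sum.
apply: eq_big_seq => b; rewrite mem_undup => bv; rewrite linearZ /=.
rewrite coef_recoef bv; case: (boolP (b \in cover_upto u)) => bu; last first.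
  by rewrite coef_out // !scale0r.
by rewrite /cover_vec gmul_comp // -mem_cover_upto.
Qed.

Definition cover_aug : ghom (free_gmod F cover_gens) V := GHom cover_fun_mul.

Lemma cover_aug_onto u : limg (cover_aug u) = fullv.
Proof.
apply/eqP; rewrite eqEsubv subvf /= -[X in (X <= _)%VS](span_basis (vbasisP _)).
apply/span_subvP => x /(nthP 0)[k]; rewrite size_tuple => kd <-.
pose b : cover_gen := Tagged (fun g => 'I_(\dim {:V g})) (Ordinal kd).
have bu : b \in cover_upto u by rewrite mem_cover_upto lepm_refl.
apply/memv_imgP; exists [ffun c : seq_sub (cover_upto u) => (val c == b)%:R : F^o].
  exact: memvf.
rewrite lfunE /= /cover_fun (bigD1 (SeqSub bu)) //= big1 ?addr0.
  by rewrite ffunE /= eqxx scale1r /cover_vec gmul_id.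
move=> c; rewrite -val_eqE /= => /negPf cb; by rewrite ffunE /= cb scale0r.
Qed.

End Cover.

Section Kernel.
Variables (F : fieldType) (n : nat) (V W : gmod F n) (f : ghom V W).

Definition gker_mul u v : 'Hom(subvs_of (lker (f u)), subvs_of (lker (f v))) :=
  (linfun (vsproj (lker (f v))) \o gmul V u v
     \o linfun (@vsval F (V u) (lker (f u))))%VF.

Lemma vsval_gker_mul u v x : (u <= v)%MM ->
  vsval (gker_mul u v x) = gmul V u v (vsval x).
Proof.
move=> uv; rewrite /gker_mul !comp_lfunE !lfunE /= vsprojK //.
rewrite memv_ker gfunP //; have := subvsP x.
by rewrite memv_ker => /eqP ->; rewrite linear0.
Qed.

Lemma gker_mul_id u x : gker_mul u u x = x.
Proof. by apply: subvs_inj; rewrite vsval_gker_mul ?lepm_refl // gmul_id. Qed.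

Lemma gker_mul_comp u v w : (u <= v)%MM -> (v <= w)%MM ->
  forall x, gker_mul v w (gker_mul u v x) = gker_mul u w x.
Proof.
move=> uv vw x; have uw := lepm_trans uv vw; apply: subvs_inj.
by rewrite !vsval_gker_mul // gmul_comp.
Qed.

Definition gker : gmod F n :=
  @GMod F n (fun u => subvs_of (lker (f u))) gker_mul gker_mul_id gker_mul_comp.

Lemma gker_incP u v : (u <= v)%MM -> forall x : gker u,
  linfun (@vsval F (V v) (lker (f v))) (gmul gker u v x)
    = gmul V u v (linfun (@vsval F (V u) (lker (f u))) x).
Proof.
move=> uv x.
transitivity (vsval (gker_mul u v x)); first exact: lfunE.
rewrite vsval_gker_mul //; congr (gmul V u v _).
exact/esym/(lfunE (@vsval F (V u) (lker (f u)))).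
Qed.

Definition gker_inc : ghom gker V := @GHom F n gker V _ gker_incP.

End Kernel.

Lemma gcomp_subproof (F : fieldType) (n : nat) (U V W : gmod F n)
    (g : ghom V W) (f : ghom U V) u v : (u <= v)%MM -> forall x,
  (g v \o f v)%VF (gmul U u v x) = gmul W u v ((g u \o f u)%VF x).
Proof. by move=> uv x; rewrite !comp_lfunE !gfunP. Qed.

Definition gcomp (F : fieldType) (n : nat) (U V W : gmod F n)
    (g : ghom V W) (f : ghom U V) : ghom U W :=
  GHom (gcomp_subproof g f).

Section StandardResolution.
Variables (F : fieldType) (n : nat) (V : gmod F n).

Fixpoint syzygy (i : nat) : gmod F n :=
  if i is j.+1 then gker (cover_aug (syzygy j)) else V.

Definition std_d (i : nat) :
  ghom (free_gmod F (cover_gens (syzygy i.+1)))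
       (free_gmod F (cover_gens (syzygy i))) :=
  gcomp (gker_inc (cover_aug (syzygy i))) (cover_aug (syzygy i.+1)).

Lemma limg_std_d i u : limg (std_d i u) = lker (cover_aug (syzygy i) u).
Proof.
rewrite [LHS]limg_comp cover_aug_onto; apply/vspaceP => x.
apply/memv_imgP/idP => [[y _ ->]|xk]; first by rewrite lfunE /= subvsP.
by exists (Subvs xk); rewrite ?memvf // lfunE.
Qed.

Lemma std_exactS i u : limg (std_d i.+1 u) = lker (std_d i u).
Proof.
rewrite limg_std_d; apply/vspaceP => x; rewrite !memv_ker.
have -> : std_d i u x = vsval (cover_aug (syzygy i.+1) u x).
  by rewrite [LHS]comp_lfunE; exact: lfunE.
apply/eqP/eqP => [-> //|h]; apply: subvs_inj; exact: h.
Qed.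

Definition std_resolution : free_resolution V :=
  @FreeRes F n V (fun i => cover_gens (syzygy i)) std_d (cover_aug V)
    (@cover_aug_onto F n V) (limg_std_d 0) std_exactS.

End StandardResolution.

(* Grade u of Tor_i^S(V, S / <x_1, ..., x_n>). *)
Definition Tor (F : fieldType) (n : nat) (V : gmod F n) (i : nat)
  (u : 'X_{1..n}) : vectType F := tor_res (std_resolution V) i u.

Record cell_complex (F : fieldType) := CellComplex {
  cell :> finType;
  cdim : cell -> nat;
  kappa : cell -> cell -> F;
  kappa_dim : forall t s, kappa t s != 0 -> cdim t = (cdim s).+1;
  kappa_sq : forall t s, \sum_r kappa t r * kappa r s = 0
}.

Definition facet (F : fieldType) (X : cell_complex F) : rel X :=
  fun s t => kappa t s != 0.

Definition face_le (F : fieldType) (X : cell_complex F) : rel X :=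
  connect (@facet F X).

Definition subcomplex (F : fieldType) (X : cell_complex F) (A : {set X}) :=
  forall s t, face_le s t -> t \in A -> s \in A.

Section Homology.
Variables (F : fieldType) (X : cell_complex F).

Definition chain : vectType F := {ffun X -> F^o}.

Definition cell_vec (c : X) : chain := [ffun s => (s == c)%:R : F^o].

Definition bnd_fun (f : chain) : chain := [ffun s => \sum_t f t * kappa t s].

Lemma bnd_fun_is_linear : linear bnd_fun.
Proof.
move=> a f g; apply/ffunP => s; rewrite !ffunE /= scaler_sumr -big_split /=.
by apply: eq_bigr => t _; rewrite !ffunE mulrDl -scalerAl.
Qed.

HB.instance Definition _ :=
  GRing.isLinear.Build F chain chain _ bnd_fun bnd_fun_is_linear.

Definition bnd : 'End(chain) := linfun bnd_fun.

Lemma bnd_cell_vec t : bnd (cell_vec t) = \sum_s kappa t s *: cell_vec s.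
Proof.
rewrite lfunE; apply/ffunP => s; rewrite ffunE sum_ffunE.
rewrite (bigD1 t) //= [in RHS](bigD1 s) //= !big1 ?addr0.
- by rewrite !ffunE !eqxx mul1r [_ *: _]mulr1.
- by move=> r rs; rewrite !ffunE eq_sym (negPf rs) scaler0.
- by move=> r rt; rewrite !ffunE (negPf rt) mul0r.
Qed.

(* C_q(A), as a subspace of the space of all chains of X. *)
Definition chains (A : {set X}) (q : nat) : {vspace chain} :=
  <<[seq cell_vec c | c <- enum A & cdim c == q]>>%VS.

Definition cycles (A : {set X}) (q : nat) : {vspace chain} :=
  (chains A q :&: lker bnd)%VS.

Definition boundaries (A : {set X}) (q : nat) : {vspace chain} :=
  (bnd @: chains A q.+1)%VS.

Definition homology (A : {set X}) (q : nat) : vectType F :=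
  subquot (cycles A q) (boundaries A q).

(* For A \subset A', the map induced by inclusion. *)
Definition homology_map (A A' : {set X}) (q : nat)
  : 'Hom(homology A q, homology A' q) :=
  (sqclass (cycles A' q) (boundaries A' q)
     \o sqrep (cycles A q) (boundaries A q))%VF.

Lemma chainsS (A A' : {set X}) q :
  A \subset A' -> (chains A q <= chains A' q)%VS.
Proof.
move=> sAA'; apply: sub_span => _ /mapP[c + ->].
rewrite mem_filter mem_enum => /andP[cq cA]; apply: map_f.
by rewrite mem_filter mem_enum cq (subsetP sAA').
Qed.

Lemma cyclesS (A A' : {set X}) q :
  A \subset A' -> (cycles A q <= cycles A' q)%VS.
Proof. by move=> sAA'; rewrite capvS // chainsS. Qed.

Lemma boundariesS (A A' : {set X}) q :
  A \subset A' -> (boundaries A q <= boundaries A' q)%VS.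
Proof. by move=> sAA'; rewrite limgS // chainsS. Qed.

Lemma homology_map_class (A A' : {set X}) q z :
  A \subset A' -> z \in cycles A q ->
  homology_map A A' q (sqclass (cycles A q) (boundaries A q) z)
    = sqclass (cycles A' q) (boundaries A' q) z.
Proof.
move=> sAA' zA; apply/eqP; rewrite comp_lfunE -subr_eq0 -linearB /=.
rewrite sqclass_eq0; first exact/(subvP (boundariesS q sAA'))/sqclass_repB.
by rewrite memvB // (subvP (cyclesS q sAA')) // sqrepP.
Qed.

End Homology.

Record filtration (F : fieldType) (X : cell_complex F) (n : nat) :=
  Filtration {
  fset :> 'X_{1..n} -> {set X};
  fset_sub : forall u, subcomplex (fset u);
  fset_mono : forall u v, (u <= v)%MM -> fset u \subset fset v
}.

Section PersistentHomology.
Variables (F : fieldType) (X : cell_complex F) (n : nat).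
Variables (XF : filtration X n) (q : nat).

Lemma ph_mul_id u (x : homology (XF u) q) : homology_map (XF u) (XF u) q x = x.
Proof. by rewrite -[x in LHS]sqrepK homology_map_class ?sqrepP // sqrepK. Qed.

Lemma ph_mul_comp u v w : (u <= v)%MM -> (v <= w)%MM ->
  forall x : homology (XF u) q,
  homology_map (XF v) (XF w) q (homology_map (XF u) (XF v) q x)
    = homology_map (XF u) (XF w) q x.
Proof.
move=> uv vw x; have uw := lepm_trans uv vw.
rewrite -[x]sqrepK !homology_map_class ?fset_mono ?sqrepP //.
by rewrite (subvP (cyclesS q (fset_mono XF uv))) ?sqrepP.
Qed.

Definition ph_module : gmod F n :=
  @GMod F n (fun u => homology (XF u) q)
    (fun u v => homology_map (XF u) (XF v) q) ph_mul_id ph_mul_comp.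

End PersistentHomology.

Definition xi (F : fieldType) (X : cell_complex F) (n : nat)
    (XF : filtration X n) (i q : nat) (u : 'X_{1..n}) : nat :=
  \dim {:Tor (ph_module XF q) i u}.

Definition supp_xi (F : fieldType) (X : cell_complex F) (n : nat)
    (XF : filtration X n) (i q : nat) (u : 'X_{1..n}) : Prop :=
  xi XF i q u <> 0%N.

Section Grades.
Variables (F : fieldType) (X : cell_complex F) (n : nat).

(* A (u - e_j), which is empty if u - e_j is not in N^n. *)
Definition prev_set (A : 'X_{1..n} -> {set X}) (u : 'X_{1..n}) (j : 'I_n)
  : {set X} := if (U_(j) <= u)%MM then A (u - U_(j))%MM else set0.

Definition ent (A : 'X_{1..n} -> {set X}) (s : X) (u : 'X_{1..n}) : bool :=
  s \in A u :\: \bigcup_(j < n) prev_set A u j.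

Definition exhaustive (A : 'X_{1..n} -> {set X}) : Prop :=
  forall s, exists u, s \in A u.

Definition one_critical (A : 'X_{1..n} -> {set X}) : Prop :=
  forall s, exists! u, ent A s u.

Definition multi_critical (A : 'X_{1..n} -> {set X}) : Prop :=
  ~ one_critical A.

(* G(G_q) and G(R_q) for the cells in Y, filtered by the sets A u; Y is
   either the set of all cells or the set of critical cells. *)
Definition gradeG (Y : {set X}) (A : 'X_{1..n} -> {set X}) (q : nat)
    (v : 'X_{1..n}) : Prop :=
  exists s, [/\ s \in Y, cdim s = q & ent A s v].

Definition gradeR (Y : {set X}) (A : 'X_{1..n} -> {set X}) (q : nat)
    (w : 'X_{1..n}) : Prop :=
  exists s, [/\ s \in Y, cdim s = q &
    exists v0 v1, [/\ ent A s v0, ent A s v1, v0 <> v1 & w = mlcm v0 v1]].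

End Grades.

(* mlcm is the least upper bound for (<= )%MM, and 0 is the least grade. *)
Definition lub_closure (n : nat) (G : 'X_{1..n} -> Prop) (w : 'X_{1..n})
  : Prop :=
  exists s : seq 'X_{1..n},
    [/\ s != [::], forall v, v \in s -> G v & w = foldr (@mlcm n) 0%MM s].

Section VectorFields.
Variables (F : fieldType) (X : cell_complex F).

(* The two entries of a pair (s, t) with s < t differ by kappa_dim, so it
   remains to say that distinct pairs have no cell in common. *)
Definition discrete_vector_field (V : {set X * X}) : Prop :=
  (forall p, p \in V -> facet p.1 p.2) /\
  (forall p p', p \in V -> p' \in V -> p <> p' ->
     [disjoint [set p.1; p.2] & [set p'.1; p'.2]]).

Definition discrete_gradient (V : {set X * X}) : Prop :=
  discrete_vector_field V /\
  ~ (exists (r : nat) (s t : nat -> X),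
       [/\ (1 <= r)%N,
           forall i, (i < r)%N ->
             [/\ (s i, t i) \in V, facet (s i.+1) (t i) & s i.+1 <> s i]
         & s r = s 0%N]).

Definition consistent (n : nat) (A : 'X_{1..n} -> {set X})
    (V : {set X * X}) : Prop :=
  forall p, p \in V -> forall u, p.1 \in A u <-> p.2 \in A u.

Definition critical (V : {set X * X}) : {set X} :=
  [set c | [forall p in V, (c != p.1) && (c != p.2)]].

End VectorFields.

Definition betti_bounds (F : fieldType) (X : cell_complex F) (n : nat)
    (XF : filtration X n) (GG GR : nat -> 'X_{1..n} -> Prop) : Prop :=
  forall q : nat,
  [/\ forall u, supp_xi XF 0 q u -> lub_closure (GG q) u,
      forall u, supp_xi XF 1 q u ->
        [\/ GR q u, GG q.+1 u | lub_closure (GG q) u],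
      forall u, supp_xi XF n q u ->
        lub_closure (fun v => GR q v \/ GG q.+1 v) u
    & forall u, (exists i, (i <= n)%N /\ supp_xi XF i q u) ->
        lub_closure (fun v => GR q v \/ GG q.+1 v) u \/
        lub_closure (GG q) u].

(* Main.v *)
From HB Require Import structures.
Require Import Defs.
From mathcomp Require Import all_boot all_order all_algebra.
From mathcomp Require Import mpoly.

(* For a free resolution P of V and a set S of variables, the homology in degree
   i of P / <x_j, j in S> P at grade v depends on S through a long exact
   sequence: adding x_k to S involves only the degrees i at v and i - 1 at
   v - e_k. Hence vanishing for a small S propagates to Tor, where S is the set
   of all variables.

   Write V_q = Z / B with Z and B increasing families of subspaces determined by
   the q-cells and by the (q+1)-cells. A grade u outside the join closure of the
   entrance grades of the q-cells has a coordinate k that is attained by none of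
   the entrance grades below u, so that Z does not change from v - e_k to v, for
   all v <= u with v_k = u_k; similarly for B and the (q+1)-cells. The first
   makes x_k surjective on V_q there, the second makes it injective. Injectivity
   alone kills Tor_n, and both together kill every Tor_i. For Tor_1, when u is
   not an entrance grade of a (q+1)-cell, it is enough that Z does not change in
   direction k and that B at u is generated from below.

   For critical cells, a chain homotopy K inverting the boundary from the
   matched (q+1)-cells to their partners makes 1 - bnd K - K bnd a projection
   onto a subcomplex spanned by the images of the critical cells, compatibly
   with the filtration; the empty vector field gives back all the cells. *)

Set Implicit Arguments.
Unset Strict Implicit.
Unset Printing Implicit Defensive.

Import GRing.Theory.
Local Open Scope ring_scope.

(** * Modules of the form <x_j, j in S> V *)

Section Grades.
Variable n : nat.
Implicit Types (u v w : 'X_{1..n}) (j k : 'I_n).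

Lemma lem_subU v w k : (v <= w)%MM -> (v k < w k)%N -> (v <= w - U_(k))%MM.
Proof.
move=> /mnm_lepP vw vk; apply/mnm_lepP => i; rewrite mnmBE mnm1E.
by case: eqP => [<-|_]; [rewrite leq_subRL ?(leq_ltn_trans _ vk) // add1n | rewrite subn0].
Qed.

Lemma lem_subU_lt v w k : (U_(k) <= w)%MM -> (v <= w - U_(k))%MM -> (v k < w k)%N.
Proof.
rewrite lep1mP -lt0n => wk /mnm_lepP/(_ k); rewrite mnmBE mnm1E eqxx.
by rewrite leq_subRL // add1n.
Qed.

Lemma lem_subU_sub v j k : (v - U_(j) - U_(k) <= v - U_(k))%MM.
Proof.
by apply/mnm_lepP=> i; rewrite !mnmBE leq_sub2r ?leq_subr.
Qed.

End Grades.

Section Irr.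
Variables (F : fieldType) (n : nat).
Implicit Types (S : {set 'I_n}) (u v w : 'X_{1..n}) (j k : 'I_n).

Definition irr_on S (V : gmod F n) v : {vspace V v} :=
  (\sum_(j in S | (U_(j) <= v)%MM) limg (gmul V (v - U_(j))%MM v))%VS.

Lemma irr_onT (V : gmod F n) v : irr_on setT V v = irr_sub V v.
Proof. by apply: eq_bigl => j; rewrite inE. Qed.

Lemma irr_on0 (V : gmod F n) v : irr_on set0 V v = 0%VS.
Proof. by apply: big_pred0 => j; rewrite inE. Qed.

Lemma irr_on_gmul S (V : gmod F n) v j (x : V (v - U_(j))%MM) :
  j \in S -> (U_(j) <= v)%MM -> gmul V _ v x \in irr_on S V v.
Proof.
move=> jS jv; rewrite /irr_on (bigD1 j) ?jS //=.
by rewrite memvE (subv_trans _ (addvSl _ _)) // -memvE memv_img ?memvf.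
Qed.

Lemma irr_onS S S' (V : gmod F n) v :
  S \subset S' -> (irr_on S V v <= irr_on S' V v)%VS.
Proof.
move=> sSS'; apply/subv_sumP => j /andP[jS jv]; apply/subvP => _ /memv_imgP[x _ ->].
by rewrite irr_on_gmul ?(subsetP sSS').
Qed.

Lemma irr_on_ghom S (V W : gmod F n) (f : ghom V W) v x :
  x \in irr_on S V v -> f v x \in irr_on S W v.
Proof.
case/memv_sumP => z zP ->; rewrite linear_sum; apply: memv_suml => j /andP[jS jv].
have /memv_imgP[t _ ->] := zP j (introT andP (conj jS jv)).
by rewrite /= gfunP ?lem_subr // irr_on_gmul.
Qed.

Lemma irr_on_mul S (V : gmod F n) v k (x : V (v - U_(k))%MM) :
  k \notin S -> x \in irr_on S V (v - U_(k))%MM -> gmul V _ v x \in irr_on S V v.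
Proof.
move=> kS /memv_sumP[z zP ->]; rewrite linear_sum; apply: memv_suml => j /andP[jS jv].
have /memv_imgP[t _ ->] := zP j (introT andP (conj jS jv)).
rewrite /= gmul_comp ?lem_subr //.
rewrite -(@gmul_comp _ _ V _ (v - U_(j))%MM) ?lem_subr ?lem_subU_sub ?irr_on_gmul //.
by apply: lepm_trans jv _; exact: lem_subr.
Qed.

Lemma irr_onU1 S (V : gmod F n) v k : k \notin S -> (U_(k) <= v)%MM ->
  irr_on (k |: S) V v = (limg (gmul V (v - U_(k))%MM v) + irr_on S V v)%VS.
Proof.
move=> kS kv; rewrite [LHS](bigD1 k) /= ?setU11 //; congr (_ + _)%VS.
apply: eq_bigl => j; rewrite !inE andbAC.
by have [->|] := eqVneq j k; rewrite ?(negPf kS) ?andbT.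
Qed.

Lemma irr_onU1_0 S (V : gmod F n) v k : ~~ (U_(k) <= v)%MM ->
  irr_on (k |: S) V v = irr_on S V v.
Proof.
move=> kv; apply: eq_bigl => j; rewrite !inE.
by have [->|] := eqVneq j k; rewrite ?(negPf kv) ?andbF.
Qed.

End Irr.

(** * Free modules and divisibility by variables *)

Section Free.
Variables (F : fieldType) (n : nat) (B : gens n).
Implicit Types (S : {set 'I_n}) (u v w : 'X_{1..n}) (j k : 'I_n).
Local Notation P := (free_gmod F B).

Lemma coef_inj u (f g : P u) : (forall b, coef f b = coef g b) -> f = g.
Proof. by move=> fg; apply/ffunP => b; rewrite -!coef_val fg. Qed.

Lemma coef_sum u (I : Type) (r : seq I) (p : pred I) (f : I -> P u) b :
  coef (\sum_(i <- r | p i) f i) b = \sum_(i <- r | p i) coef (f i) b.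
Proof.
rewrite /coef; case: insub => [c|]; last by rewrite big1.
by rewrite sum_ffunE.
Qed.

Lemma coef_gdeg u (f : P u) b : coef f b != 0 -> (gdeg b <= u)%MM.
Proof.
by rewrite -mem_gens_upto; apply: contraNT => /(coef_out f) ->.
Qed.

Lemma coef_gmul u v (f : P u) b : (u <= v)%MM -> coef (gmul P u v f) b = coef f b.
Proof.
move=> uv; rewrite lfunE /= coef_recoef; case: ifPn => // bv.
rewrite coef_out //; apply: contra bv; rewrite !mem_gens_upto => /lepm_trans; exact.
Qed.

(** In grade [v] the generator [b] carries the monomial x^(v - [gdeg b]), and x_j divides it exactly
    when [gdeg b j < v j]. *)
Lemma mem_irr_on_free S v (f : P v) :
  f \in irr_on S P v <->
  (forall b, coef f b != 0 -> exists2 j, j \in S & (gdeg b j < v j)%N).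
Proof.
split=> [/memv_sumP[g gP ->] b|H].
  rewrite coef_sum => nz; apply/exists_inP; apply: contraNT nz.
  rewrite negb_exists_in => /forall_inP H; apply/eqP; apply: big1 => j /andP[jS jv].
  have /memv_imgP[h _ ->] := gP j (introT andP (conj jS jv)).
  rewrite coef_gmul ?lem_subr //; apply/eqP; apply: contraNT (H j jS).
  by move/coef_gdeg/(lem_subU_lt jv).
have -> : f = \sum_b ([ffun c => if c == b then f b else 0] : P v).
  apply/ffunP => c; rewrite sum_ffunE (bigD1 c) //= big1 ?addr0 ?ffunE ?eqxx //.
  by move=> b bc; rewrite ffunE eq_sym (negPf bc).
apply: memv_suml => b _; set g := finfun _.
have [f0|nz] := eqVneq (f b) 0.
  suff -> : g = 0 by exact: mem0v.
  by apply/ffunP => c; rewrite !ffunE f0 if_same.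
have [|j jS jb] := H (val b); first by rewrite coef_val.
have jv : (U_(j) <= v)%MM by rewrite lep1mP -lt0n (leq_ltn_trans _ jb).
have bv : (gdeg (val b) <= v - U_(j))%MM.
  by rewrite lem_subU // -mem_gens_upto; exact: valP.
have -> : g = gmul P (v - U_(j))%MM v (recoef (gens_upto B (v - U_(j))%MM) g).
  apply: coef_inj => c; rewrite coef_gmul ?lem_subr // coef_recoef.
  rewrite mem_gens_upto; case: ifPn => // cv; rewrite /coef; case: insubP => //= d _ dc.
  by rewrite ffunE; case: eqP => // db; rewrite -dc db bv in cv.
exact: irr_on_gmul.
Qed.

(** For k outside [S], x_k is a nonzerodivisor on P / <x_j, j in S> P; this is what yields the long
    exact sequence. *)
Lemma irr_on_free_mul S v k (f : P (v - U_(k))%MM) : k \notin S ->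
  gmul P _ v f \in irr_on S P v -> f \in irr_on S P (v - U_(k))%MM.
Proof.
move=> kS /mem_irr_on_free H; apply/mem_irr_on_free => b fb.
have [|j jS jb] := H b; first by rewrite coef_gmul ?lem_subr.
exists j => //; rewrite mnmBE mnm1E; case: eqP => [kj|_]; last by rewrite subn0.
by rewrite kj jS in kS.
Qed.

End Free.

(** * Quotients of a resolution by sets of variables *)

Section RelativeVanishing.
Variables (F : fieldType) (n : nat) (V : gmod F n) (P : free_resolution V).
Implicit Types (S : {set 'I_n}) (u v w : 'X_{1..n}) (j k : 'I_n).
Local Notation P_ i := (free_gmod F (res_gens P i)).

(** Cycles of P / <x_j, j in S> P are handled through representatives in P. The augmentation is left
    out, so in degree 0 every element is a cycle. *)
Definition relcycle S i v : P_ i v -> Prop :=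
  match i return P_ i v -> Prop with
  | 0 => fun=> True
  | j.+1 => fun x => res_d P j v x \in irr_on S (P_ j) v
  end.

(* P / <x_j, j in S> P is exact in homological degree i and grade v. *)
Definition vanish S i v : Prop :=
  forall x : P_ i v, relcycle S x ->
  exists y, x - res_d P i v y \in irr_on S (P_ i) v.

Lemma gmulB (W : gmod F n) u v (x y : W u) :
  gmul W u v (x - y) = gmul W u v x - gmul W u v y.
Proof. exact: linearB. Qed.

Lemma res_dB i v x y : res_d P i v (x - y) = res_d P i v x - res_d P i v y.
Proof. exact: linearB. Qed.

Lemma res_dd i v x : res_d P i v (res_d P i.+1 v x) = 0.
Proof.
by apply/eqP; rewrite -memv_ker -res_exactS memv_img ?memvf.
Qed.

Lemma res_d_exact i v x : res_d P i v x = 0 -> exists y, x = res_d P i.+1 v y.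
Proof.
move/eqP; rewrite -memv_ker -res_exactS => /memv_imgP[y _ ->]; by exists y.
Qed.

Lemma vanish_exact i v : vanish set0 i.+1 v.
Proof.
move=> x /=; rewrite irr_on0 memv0 => /eqP/res_d_exact[y ->].
by exists y; rewrite subrr mem0v.
Qed.

Lemma vanishS0 S S' v : S \subset S' -> vanish S 0 v -> vanish S' 0 v.
Proof.
move=> sSS' vS x _; have [//|y yP] := vS x.
by exists y; exact: (subvP (irr_onS _ _ sSS')).
Qed.

(** This is a diagram chase in the long exact sequence of 0 -> Q(-e_k) -> Q -> Q / x_k Q -> 0, where
    Q = P / <x_j, j in S> P. *)
Lemma vanishU1 S i v k : k \notin S -> vanish S i.+1 v ->
  ((U_(k) <= v)%MM -> vanish S i (v - U_(k))%MM) -> vanish (k |: S) i.+1 v.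
Proof.
move=> kS vS vSk x /=; have [kv|kv] := boolP (U_(k) <= v)%MM; last first.
  by rewrite irr_onU1_0 // => /vS[y yP]; exists y; rewrite irr_onU1_0.
rewrite irr_onU1 // => /memv_addP[_ /memv_imgP[p _ ->] [h hS dxE]].
(* In positive degree d (d x) = 0 gives x_k d p = - d h, and x_k cancels modulo the variables of
   [S]. *)
have cp : relcycle S p.
  case: i x p h {vS vSk} hS dxE => [//|i] x p h hS dxE.
  apply: (irr_on_free_mul kS); rewrite -gfunP ?lem_subr //.
  have -> : gmul (P_ i.+1) (v - U_(k))%MM v p = res_d P i.+1 v x - h.
    by rewrite dxE addrK.
  by rewrite res_dB res_dd sub0r memvN irr_on_ghom.
have [y' y'P] := vSk kv p cp.
(* Subtracting x_k y' turns x into a cycle modulo the variables of [S] alone. *)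
have [/=|y yP] := vS (x - gmul (P_ i.+1) (v - U_(k))%MM v y').
  rewrite res_dB gfunP ?lem_subr // dxE addrAC -gmulB.
  by apply: memvD => //; apply: (@irr_on_mul _ _ S (P_ i) v k _ kS y'P).
exists y; rewrite irr_onU1 //.
apply/memv_addP; exists (gmul (P_ i.+1) (v - U_(k))%MM v y'); first by rewrite memv_img ?memvf.
by eexists; first exact: yP; rewrite [RHS]addrC (addrAC x) subrK.
Qed.

Lemma dim_tor_res i u : vanish setT i u -> \dim {:tor_res P i u} = 0%N.
Proof.
move=> vT; apply/eqP; rewrite dimv_eq0 -subv0; apply/subvP => y _; rewrite memv0.
rewrite -[y]sqrepK; set z := sqrep _ _ y; have zZ : z \in tor_cycles P i u := sqrepP y.
rewrite sqclass_eq0 //; clearbody z => {y}.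
have [|y] := vT (vrep _ z).
  case: i z zZ {vT} => [//|i] z; rewrite memv_ker => /eqP dz.
  by rewrite /relcycle irr_onT -vpi_eq0 -tensF_map_pi vrepK dz.
rewrite irr_onT => yP.
have -> : z = tensF_map (res_d P i) u (vpi (irr_sub _ u) y).
  by apply/eqP; rewrite tensF_map_pi -subr_eq0 -{1}[z]vrepK -linearB /= vpi_eq0.
by rewrite memv_img ?memvf.
Qed.

End RelativeVanishing.

(** * Modules presented by increasing subspaces *)

Section Drawn.
Variables (F : fieldType) (n : nat) (E : vectType F).
Implicit Types (W : 'X_{1..n} -> {vspace E}) (S : {set 'I_n}).

(** For increasing [W], seen as a graded module with inclusions as multiplications, this says that W
    / <x_j, j in S> W is zero in grade [v]. *)
Definition drawn W S v : Prop :=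
  (W v <= \sum_(j in S | (U_(j) <= v)%MM) W (v - U_(j))%MM)%VS.

Lemma drawn1 W k v :
  drawn W [set k] v <-> (W v <= if (U_(k) <= v)%MM then W (v - U_(k))%MM else 0)%VS.
Proof. by rewrite /drawn big_mkcondr big_set1. Qed.

Lemma drawnS W S S' v : S \subset S' -> drawn W S v -> drawn W S' v.
Proof.
move=> sSS' dS; apply: (subv_trans dS); apply/subv_sumP => j /andP[jS jv].
by rewrite (bigD1 j) /= ?(subsetP sSS') ?addvSl.
Qed.

End Drawn.

(** All grades share the space [E], so multiplication keeps representatives unchanged. The class map
    is linear on [E] but constrained only on [Z v]. *)
Record presentation (F : fieldType) (n : nat) (V : gmod F n) (E : vectType F)
    (Z B : 'X_{1..n} -> {vspace E}) (cl : forall v, 'Hom(E, V v)) : Prop :=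
  Presentation {
  pres_sub : forall v, (B v <= Z v)%VS;
  pres_onto : forall v y, exists2 z, z \in Z v & cl v z = y;
  pres_eq0 : forall v z, z \in Z v -> (cl v z == 0) = (z \in B v);
  pres_mono : forall v w, (v <= w)%MM -> (Z v <= Z w)%VS;
  pres_mul : forall v w z, (v <= w)%MM -> z \in Z v ->
    gmul V v w (cl v z) = cl w z
}.

(** * Vanishing criteria for a presented module *)

Section Vanishing.
Variables (F : fieldType) (n : nat) (V : gmod F n) (P : free_resolution V).
Variables (E : vectType F) (Z B : 'X_{1..n} -> {vspace E}).
Variable (cl : forall v, 'Hom(E, V v)).
Hypothesis pr : presentation Z B cl.
Implicit Types (S : {set 'I_n}) (u v w : 'X_{1..n}) (j k l : 'I_n).
Local Notation P_ i := (free_gmod F (res_gens P i)).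
Local Notation aug := (res_aug P).

Lemma gmul_aug v w x : (v <= w)%MM ->
  aug w (gmul (P_ 0) v w x) = gmul V v w (aug v x).
Proof. by move=> vw; rewrite gfunP. Qed.

Lemma augB v x y : aug v (x - y) = aug v x - aug v y.
Proof. exact: linearB. Qed.

Lemma lift_class v z : exists x, aug v x = cl v z.
Proof.
have : cl v z \in limg (aug v) by rewrite res_onto memvf.
by case/memv_imgP => x _ ->; exists x.
Qed.

Lemma class_of v x : exists2 z, z \in Z v & aug v x = cl v z.
Proof. by have [z zZ <-] := pres_onto pr (aug v x); exists z. Qed.

Lemma aug_exact v x : aug v x = 0 -> exists y, x = res_d P 0 v y.
Proof.
by move/eqP; rewrite -memv_ker -res_exact0 => /memv_imgP[y _ ->]; exists y.
Qed.

Lemma aug_d v x : aug v (res_d P 0 v x) = 0.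
Proof. by apply/eqP; rewrite -memv_ker -res_exact0 memv_img ?memvf. Qed.

(** The homology in degree 0 is V / <x_j, j in S> V, a quotient of Z / <x_j, j in S> Z. *)
Lemma vanish_drawn0 S v : drawn Z S v -> vanish P S 0 v.
Proof.
move=> dS x _; have [z zZ xE] := class_of x.
have : (cl v @: (\sum_(j in S | (U_(j) <= v)%MM) Z (v - U_(j))%MM)
          <= aug v @: irr_on S (P_ 0) v)%VS.
  rewrite limg_sum; apply/subv_sumP => j /andP[jS jv].
  apply/subvP => _ /memv_imgP[t tZ ->]; have [p pE] := lift_class (v - U_(j))%MM t.
  rewrite -(pres_mul pr _ tZ) ?lem_subr // -pE -gmul_aug ?lem_subr //.
  by rewrite memv_img // irr_on_gmul.
move/subvP/(_ _ (memv_img _ (subvP dS _ zZ)))/memv_imgP => [p pS pE].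
have [|y yE] := @aug_exact v (x - p); first by rewrite augB xE pE subrr.
by exists y; rewrite -yE subKr.
Qed.

Definition syz_on S v : {vspace P_ 0 v} :=
  (\sum_(j in S | (U_(j) <= v)%MM)
     gmul (P_ 0) (v - U_(j))%MM v @: lker (aug (v - U_(j))%MM))%VS.

Lemma syz_on_gmul S v j x : j \in S -> (U_(j) <= v)%MM ->
  aug (v - U_(j))%MM x = 0 -> gmul (P_ 0) _ v x \in syz_on S v.
Proof.
move=> jS jv /eqP x0; rewrite /syz_on (bigD1 j) ?jS //=.
by apply: (subvP (addvSl _ _)); rewrite memv_img ?memv_ker.
Qed.

Lemma syz_on_aug S v x : x \in syz_on S v -> aug v x = 0.
Proof.
case/memv_sumP => z zP ->; rewrite linear_sum big1 //= => j jP.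
have /memv_imgP[t + ->] := zP j jP; rewrite memv_ker => /eqP t0.
by rewrite gmul_aug ?lem_subr // t0 linear0.
Qed.

(** With I = <x_j, j in S> and N the kernel of the augmentation, [syz_on S] is I N, and the homology
    in degree 1 is the quotient of the intersection of N and I P_0 by I N. *)
Lemma vanish1P S v :
  (forall p, p \in irr_on S (P_ 0) v -> aug v p = 0 -> p \in syz_on S v) ->
  vanish P S 1 v.
Proof.
move=> H x /= dxS.
have : (syz_on S v <= res_d P 0 v @: irr_on S (P_ 1) v)%VS.
  apply/subv_sumP => j /andP[jS jv]; apply/subvP => _ /memv_imgP[t + ->].
  rewrite memv_ker => /eqP/aug_exact[y ->].
  by rewrite -gfunP ?lem_subr // memv_img // irr_on_gmul.
move/subvP/(_ _ (H _ dxS (aug_d x)))/memv_imgP => [q qS qE].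
have [|y yE] := @res_d_exact _ _ _ P 0 v (x - q); first by rewrite res_dB qE subrr.
by exists y; rewrite -yE subKr.
Qed.

(** For one variable the homology in degree 1 is the kernel of x_l on V from v - e_l to v, and a
    representative in [B v] is already in [B] at v - e_l. *)
Lemma vanish_drawn1 l v : drawn B [set l] v -> vanish P [set l] 1 v.
Proof.
move/drawn1 => dl; apply: vanish1P => p.
rewrite -(setU0 [set l]); case: ifPn dl => lv dl; last first.
  by rewrite irr_onU1_0 // irr_on0 memv0 => /eqP -> _; exact: mem0v.
rewrite irr_onU1 ?inE // irr_on0 addv0 => /memv_imgP[t _ ->].
rewrite gmul_aug ?lem_subr // => t0; apply: syz_on_gmul; rewrite ?inE ?eqxx //.
have [z zZ tE] := class_of t; rewrite tE; apply/eqP; rewrite (pres_eq0 pr) //.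
apply: (subvP dl); rewrite -(pres_eq0 pr) ?(subvP (pres_mono pr (lem_subr _ _)) _ zZ) //.
by rewrite -(pres_mul pr _ zZ) ?lem_subr // -tE t0.
Qed.

Lemma vanish_drawnS l i v : drawn B [set l] v -> vanish P [set l] i.+1 v.
Proof.
case: i => [|i]; first exact: vanish_drawn1.
move=> _; rewrite -(setU0 [set l]).
by apply: vanishU1; rewrite ?inE // => *; apply: vanish_exact.
Qed.

(** Let N be the kernel of the augmentation and I = <x_j, j in S>. Modulo I N, p becomes a multiple
    x_k q, because [Z] is constant in direction k. The relation in [B v] satisfied by q is then
    split into relations of lower grades. *)
Lemma vanish_drawn_pair k S v : k \in S ->
  (forall w, (w <= v)%MM -> w k = v k -> drawn Z [set k] w) ->
  drawn B S v -> vanish P S 1 v.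
Proof.
move=> kS dZ dB; apply: vanish1P => p pS.
have sub_k j : j != k -> (v - U_(j))%MM k = v k.
  by move=> /negPf jk; rewrite mnmBE mnm1E jk subn0.
have dZj j : j != k -> drawn Z [set k] (v - U_(j))%MM.
  by move=> jk; apply: dZ; rewrite ?lem_subr ?sub_k.
(* If v - e_k is not a grade, then [Z] is zero at v - e_j for all j <> k, so P_0 and N agree
   there. *)
have [kv|kv] := boolP (U_(k) <= v)%MM; last first.
  move=> _; apply: (subvP _ _ pS); apply/subv_sumP => j /andP[jS jv].
  apply/subvP => _ /memv_imgP[t _ ->]; apply: syz_on_gmul => //.
  have jk : j != k by apply: contraNneq kv => <-.
  have /drawn1 := dZj _ jk; rewrite lep1mP sub_k // -lep1mP (negPf kv).
  by have [z zZ ->] := class_of t => /subvP/(_ _ zZ); rewrite memv0 => /eqP ->; rewrite linear0.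
have ZjP j z : j != k -> z \in Z (v - U_(j))%MM ->
    exists2 r : P_ 0 (v - U_(j) - U_(k))%MM, z \in Z (v - U_(j) - U_(k))%MM & aug _ r = cl _ z.
  move=> jk zZ; have /drawn1 := dZj _ jk.
  rewrite lep1mP sub_k // -lep1mP kv => /subvP/(_ _ zZ) zZ'.
  by have [r rE] := lift_class (v - U_(j) - U_(k))%MM z; exists r.
(* For j <> k the class of t comes from v - e_j - e_k, so t differs from some x_k r by an element of
   N. *)
have split : (irr_on S (P_ 0) v <=
    syz_on S v + limg (gmul (P_ 0) (v - U_(k))%MM v))%VS.
  apply/subv_sumP => j /andP[jS jv]; apply/subvP => _ /memv_imgP[t _ ->].
  have [jk|jk] := eqVneq j k.
    by subst j; apply: (subvP (addvSr _ _)); rewrite memv_img ?memvf.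
  have [z zZ tE] := class_of t; have [r zZ' rE] := ZjP j z jk zZ.
  pose r1 := gmul (P_ 0) _ (v - U_(j))%MM r.
  apply/memv_addP; exists (gmul (P_ 0) _ v (t - r1)).
    apply: syz_on_gmul => //; rewrite augB gmul_aug ?lem_subr // tE rE.
    by rewrite (pres_mul pr) ?lem_subr ?subrr.
  exists (gmul (P_ 0) _ v r1); last by rewrite gmulB subrK.
  rewrite gmul_comp ?lem_subr //.
  rewrite -(@gmul_comp _ _ (P_ 0) _ (v - U_(k))%MM) ?lem_subr ?lem_subU_sub //.
  by rewrite memv_img ?memvf.
have /memv_addP[a aN [_ /memv_imgP[q _ ->] ->]] := subvP split _ pS.
rewrite linearD /= (syz_on_aug aN) add0r gmul_aug ?lem_subr // => q0.
rewrite memvD //; have [z zZ qE] := class_of q.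
have zB : z \in B v.
  rewrite -(pres_eq0 pr) ?(subvP (pres_mono pr (lem_subr _ _)) _ zZ) //.
  by rewrite -(pres_mul pr _ zZ) ?lem_subr // -qE q0.
(* The part of z in [B] at v - e_k has class zero there. For j <> k, a part b in [B] at v - e_j has
   its class at v - e_k lifted by x_j r, with r in grade v - e_j - e_k and x_k r in N; so x_k (x_j
   r) = x_j (x_k r) is in I N. *)
have : (cl (v - U_(k))%MM @: (\sum_(j in S | (U_(j) <= v)%MM) B (v - U_(j))%MM)
   <= aug _ @: (gmul (P_ 0) (v - U_(k))%MM v @^-1: syz_on S v))%VS.
  rewrite limg_sum; apply/subv_sumP => j /andP[jS jv].
  apply/subvP => _ /memv_imgP[b bB ->]; have bZ := subvP (pres_sub pr _) _ bB.
  have [jk|jk] := eqVneq j k.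
    subst j; have /eqP-> : cl (v - U_(k))%MM b == 0 by rewrite (pres_eq0 pr).
    exact: mem0v.
  have [r bZ' rE] := ZjP j b jk bZ.
  rewrite -(pres_mul pr _ bZ') ?lem_subU_sub // -rE -gmul_aug ?lem_subU_sub //.
  rewrite memv_img // -memv_preim gmul_comp ?lem_subU_sub ?lem_subr //.
  rewrite -(@gmul_comp _ _ (P_ 0) _ (v - U_(j))%MM) ?lem_subr //.
  apply: syz_on_gmul => //; rewrite gmul_aug ?lem_subr // rE.
  by rewrite (pres_mul pr) ?lem_subr //; apply/eqP; rewrite (pres_eq0 pr).
move/subvP/(_ _ (memv_img _ (subvP dB _ zB)))/memv_imgP => [t].
rewrite -memv_preim => tN tE; rewrite -(subrK t q) linearD /= memvD //.
by apply: syz_on_gmul => //; rewrite augB -tE qE subrr.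
Qed.

(* c = true is for vanishing in positive degrees only: each variable added to S
   then costs one degree. *)
Lemma vanish_extend (c : bool) S0 u :
  (forall i v, (v <= u)%MM -> {in S0, forall j, v j = u j} ->
     (c * #|S0| <= i)%N -> vanish P S0 i v) ->
  forall S i v, S0 \subset S -> (v <= u)%MM -> {in S0, forall j, v j = u j} ->
    (c * #|S| <= i)%N -> vanish P S i v.
Proof.
move=> H0 S; have [m] := ubnP #|S :\: S0|.
elim: m S => // m IHm S Sm i v S0S vu vS0 ci.
have [S_S0|[k]] := set_0Vmem (S :\: S0).
  suff -> : S = S0 by apply: H0 => //; apply: leq_trans ci; rewrite leq_mul ?subset_leq_card.
  by apply/eqP; rewrite eqEsubset S0S andbT -setD_eq0 S_S0.
rewrite inE => /andP[kS0 kS].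
have S0S' : S0 \subset S :\ k.
  by apply/subsetP => j jS0; rewrite !inE (subsetP S0S) // andbT; apply: contraNneq kS0 => <-.
have S'm : (#|(S :\ k) :\: S0| < m)%N.
  rewrite -ltnS; apply: leq_trans Sm; rewrite ltnS [X in (_ < X)%N](cardsD1 k) !inE kS kS0 /=.
  by rewrite add1n ltnS subset_leq_card //; apply/subsetP => j; rewrite !inE => /and3P[-> -> ->].
move: ci; rewrite (cardsD1 k) kS => ci; rewrite -(setD1K kS).
(* Degree 0 has no lower neighbour in the sequence, but there vanishing persists when [S] grows. *)
case: i ci => [|i] ci.
  apply: (@vanishS0 _ _ _ _ (S :\ k)); first exact: subsetUr.
  apply: IHm => //; apply: leq_trans ci; by rewrite leq_mul // leq_addl.
have ci' : (c * #|S :\ k| <= i)%N by case: c ci {H0 IHm}; rewrite ?mul1n ?mul0n ?add1n.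
apply: vanishU1; rewrite ?inE ?eqxx //; first by apply: IHm => //; apply: leqW.
move=> kv; apply: IHm => //; first exact: lepm_trans (lem_subr _ _) vu.
move=> j jS0; rewrite mnmBE mnm1E -vS0 //; case: eqP => [kj|_]; last by rewrite subn0.
by rewrite kj jS0 in kS0.
Qed.

(** The other n - 1 variables cost one degree each, leaving degree at least 1 for the quotient by
    x_l, where [B] decides. *)
Lemma vanish_top l u : (forall v, (v <= u)%MM -> v l = u l -> drawn B [set l] v) ->
  vanish P setT n u.
Proof.
move=> dB; apply: (@vanish_extend true [set l] u); rewrite ?subsetT ?lepm_refl //.
  move=> [|i] v vu vl; rewrite mul1n cards1 // => _.
  by apply: vanish_drawnS; apply: dB; rewrite ?vl ?inE.
by rewrite mul1n cardsT card_ord.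
Qed.

Lemma vanish_all k l u :
  (forall v, (v <= u)%MM -> v k = u k -> drawn Z [set k] v) ->
  (forall v, (v <= u)%MM -> v l = u l -> drawn B [set l] v) ->
  forall i, vanish P setT i u.
Proof.
move=> dZ dB i.
apply: (@vanish_extend false [set k; l] u); rewrite ?subsetT ?lepm_refl ?mul0n //.
move=> {}i v vu vkl _; have vk : v k = u k by rewrite vkl ?inE ?eqxx.
have vl : v l = u l by rewrite vkl ?inE ?eqxx ?orbT.
case: i => [|[|i]].
- by apply/vanish_drawn0/drawnS/dZ => //; apply/subsetP => j; rewrite !inE => ->.
- apply: (@vanish_drawn_pair k); first by rewrite !inE eqxx.
    by move=> w wv wk; apply: dZ; [apply: lepm_trans vu | rewrite wk].
  by apply/drawnS/dB => //; apply/subsetP => j; rewrite !inE => ->; rewrite orbT.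
(* From degree 2 on, adding x_k to x_l involves only positive degrees of the quotient by x_l, and v
   - e_k has the same l-th coordinate as v. *)
have [kl|kl] := eqVneq k l; first by rewrite kl setUid; apply/vanish_drawnS/dB.
apply: vanishU1; first by rewrite inE.
  exact/vanish_drawnS/dB.
move=> _; apply/vanish_drawnS/dB; first exact: lepm_trans (lem_subr _ _) vu.
by rewrite mnmBE mnm1E (negPf kl) subn0.
Qed.

End Vanishing.

(** * Entrance grades and reductions of the chain complex *)

Section Chains.
Variables (F : fieldType) (X : cell_complex F).
Implicit Types (A : {set X}) (f : chain X) (s t : X) (q : nat).

Lemma chain_sum f : f = \sum_s f s *: cell_vec s.
Proof.
apply/ffunP => s; rewrite sum_ffunE (bigD1 s) //= big1 ?addr0.
  by rewrite !ffunE eqxx [_ *: _]mulr1.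
by move=> t ts; rewrite !ffunE eq_sym (negPf ts) scaler0.
Qed.

Lemma mem_chains A q f :
  f \in chains A q <-> (forall s, f s != 0 -> s \in A /\ cdim s = q).
Proof.
split=> [fA s|H].
  rewrite (coord_span (X := in_tuple _) fA) sum_ffunE /= => nz.
  have [i ni] : exists i : 'I_(size [seq cell_vec c | c <- enum A & cdim c == q]),
      [seq cell_vec c | c <- enum A & cdim c == q]`_i s != 0.
    apply/existsP; apply: contraNT nz; rewrite negb_exists => /forallP H.
    apply/eqP; apply: big1 => i _; rewrite ffunE.
    by have := H i; rewrite negbK => /eqP ->; rewrite scaler0.
  have /mapP[c + cE] := mem_nth 0 (ltn_ord i).
  rewrite mem_filter mem_enum => /andP[/eqP cq cA].
  by move: ni; rewrite cE ffunE; case: (s =P c) => [-> //|_]; rewrite eqxx.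
rewrite [f]chain_sum; apply: memv_suml => s _.
have [->|/H[sA sq]] := eqVneq (f s) 0; first by rewrite scale0r mem0v.
by rewrite memvZ // memv_span // map_f // mem_filter sq eqxx mem_enum.
Qed.

Lemma bndE f s : bnd X f s = \sum_t f t * kappa t s.
Proof. by rewrite lfunE ffunE. Qed.

Lemma bnd_sumZ (p : pred X) (a : X -> F) (g : X -> chain X) s :
  bnd X (\sum_(t | p t) a t *: g t) s = \sum_(t | p t) a t * bnd X (g t) s.
Proof.
by rewrite linear_sum sum_ffunE; apply: eq_bigr => t _; rewrite linearZ ffunE.
Qed.

Lemma bnd_bnd f : bnd X (bnd X f) = 0.
Proof.
apply/ffunP => s; rewrite bndE ffunE.
under eq_bigr => t _ do rewrite bndE mulr_suml.
rewrite exchange_big /= big1 // => t _.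
under eq_bigr => r _ do rewrite -mulrA.
by rewrite -mulr_sumr [X in _ * X](kappa_sq t s) mulr0.
Qed.

Lemma bnd_chains A q f : subcomplex A -> f \in chains A q.+1 -> bnd X f \in chains A q.
Proof.
move=> sA /mem_chains fA; apply/mem_chains => s; rewrite bndE => nz.
have [t] : exists t, f t * kappa t s != 0.
  apply/existsP; apply: contraNT nz; rewrite negb_exists => /forallP H.
  by apply/eqP; apply: big1 => t _; apply/eqP; have := H t; rewrite negbK.
rewrite mulf_eq0 negb_or => /andP[/fA[tA tq] k0].
split; first by apply: sA tA; apply: connect1.
by have := kappa_dim k0; rewrite tq => -[].
Qed.

Lemma bnd_chains0 A f : f \in chains A 0 -> bnd X f = 0.
Proof.
move=> /mem_chains fA; apply/ffunP => s; rewrite bndE ffunE big1 // => t _.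
apply/eqP; rewrite mulf_eq0; have [//|/fA[_ t0]] := eqVneq (f t) 0.
by apply: contraT => /kappa_dim; rewrite t0.
Qed.

End Chains.

Section Gaps.
Variable n : nat.
Implicit Types (u v : 'X_{1..n}) (k : 'I_n).

Lemma foldr_mlcm_lem (s : seq 'X_{1..n}) u :
  (foldr (@mlcm n) 0 s <= u)%MM = all (fun v => (v <= u)%MM) s.
Proof.
elim: s => [|v s IHs] /=; last by rewrite lem_mlcm IHs.
by apply/mnm_lepP => i; rewrite mnm0E.
Qed.

Lemma lub_closureS (G G' : 'X_{1..n} -> Prop) u :
  (forall v, G v -> G' v) -> lub_closure G u -> lub_closure G' u.
Proof. by move=> GG' [s [s0 sG ->]]; exists s; split=> // v /sG/GG'. Qed.

(* If every coordinate of u is attained by some grade of G below u, then these n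
   grades have join u. *)
Lemma lub_closure_gap (G : pred 'X_{1..n}) u : (0 < n)%N ->
  lub_closure G u \/ exists k, forall v, G v -> (v <= u)%MM -> (v k < u k)%N.
Proof.
(* Bounding the degree by [mdeg u] gives a finite type that contains every grade below [u]. *)
move=> n0; have [|] := boolP [forall k : 'I_n,
  [exists v : 'X_{1..n < (mdeg u).+1}, [&& G v, (v <= u)%MM & v k == u k :> nat]]].
  move/forallP => H; have [g gP] := fin_all_exists (fun k => existsP (H k)); left.
  exists [seq (g k : 'X_{1..n}) | k <- enum 'I_n]; split.
  - by rewrite -size_eq0 size_map size_enum_ord -lt0n.
  - by move=> v /mapP[k _ ->]; have /and3P[] := gP k.
  have leu : (foldr (@mlcm n) 0 [seq (g k : 'X_{1..n}) | k <- enum 'I_n] <= u)%MM.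
    by rewrite foldr_mlcm_lem; apply/allP => v /mapP[k _ ->]; have /and3P[] := gP k.
  apply/mnmP => i; apply/eqP; rewrite eqn_leq (mnm_lepP leu) andbT.
  have /and3P[_ _ /eqP <-] := gP i; apply: (fun H => mnm_lepP H i).
  move: (lepm_refl (foldr (@mlcm n) 0 [seq (g k : 'X_{1..n}) | k <- enum 'I_n])%MM).
  by rewrite foldr_mlcm_lem => /allP; apply; apply/mapP; exists i; rewrite ?mem_enum.
rewrite negb_forall => /existsP[k]; rewrite negb_exists => /forallP H; right; exists k.
move=> v Gv vu; have vd : (mdeg v < (mdeg u).+1)%N by rewrite ltnS -(submK vu) mdegD leq_addl.
have := H (BMultinom vd); rewrite /= Gv vu /= => vk.
by rewrite ltn_neqAle vk (mnm_lepP vu).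
Qed.

End Gaps.

Section Reduction.
Variables (F : fieldType) (X : cell_complex F) (n : nat) (XF : filtration X n).
Implicit Types (Y : {set X}) (u v : 'X_{1..n}) (s : X) (q : nat).

(** Stepping down while [s] stays present lowers the degree, so it stops at an entrance grade. *)
Lemma entP s v : s \in XF v -> exists2 g, (g <= v)%MM & ent XF s g.
Proof.
have [m] := ubnP (mdeg v); elim: m v => // m IHm v vm sv.
have [es|] := boolP (ent XF s v); first by exists v; [exact: lepm_refl | exact: es].
rewrite /ent inE sv andbT negbK => /bigcupP[j _]; rewrite /prev_set.
case: ifP => [jv sj|_]; last by rewrite inE.
have [|g gv eg] := IHm _ _ sj; last by exists g => //; exact: lepm_trans gv (lem_subr _ _).
by rewrite -ltnS; apply: leq_trans vm; rewrite -[in X in (_ < X)%N](submK jv) mdegD mdeg1 addn1.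
Qed.

Lemma entI Y s v : s \in Y -> ent (fun u => Y :&: XF u) s v = ent XF s v.
Proof.
move=> sY; rewrite /ent !inE sY; congr (~~ _ && _).
apply/bigcupP/bigcupP => -[j _]; rewrite /prev_set; case: ifP => // jv sj; exists j => //.
- by rewrite jv; move: sj; rewrite inE => /andP[].
- by move: sj; rewrite inE.
- by rewrite jv inE sY.
- by move: sj; rewrite inE.
Qed.

(* A projection of the chain complex of X onto a subcomplex, homotopic to the
   identity compatibly with the filtration and determined by the cells of Y. *)
Record reduction Y (phi : 'End(chain X)) : Prop := Reduction {
  red_bnd : forall f, phi (bnd X f) = bnd X (phi f);
  red_homotopic : forall u q z, z \in cycles (XF u) q ->
    z - phi z \in boundaries (XF u) q;
  red_chains : forall u q, (phi @: chains (XF u) q <= chains (XF u) q)%VS;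
  red_idem : forall f, phi (phi f) = phi f;
  red_cells : forall u q,
    (phi @: chains (XF u) q <= phi @: chains (XF u :&: Y) q)%VS
}.

(** * Support bounds from a reduction *)

Section Bounds.
Variables (Y : {set X}) (phi : 'End(chain X)).
Hypothesis phiP : reduction Y phi.

Definition red_image q u := (phi @: chains (XF u) q)%VS.
Definition red_cycles q u := (red_image q u :&: lker (bnd X))%VS.
Definition red_bounds q u := (bnd X @: red_image q.+1 u)%VS.

Lemma red_cyclesW q u z : z \in red_cycles q u -> phi z = z /\ z \in cycles (XF u) q.
Proof.
rewrite memv_cap => /andP[/memv_imgP[c cC ->] zk]; rewrite (red_idem phiP); split=> //.
by rewrite memv_cap zk (subvP (red_chains phiP _ _)) // memv_img.
Qed.

(** The image of [phi] computes homology since [phi] is homotopic to the identity. A cycle of the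
    image that bounds c in [XF u] bounds phi c, by idempotence. *)
Lemma red_presentation q :
  @presentation F n (ph_module XF q) (chain X) (red_cycles q) (red_bounds q)
    (fun u => sqclass (cycles (XF u) q) (boundaries (XF u) q)).
Proof.
have C v := red_chains phiP v; split=> [v|v y|v z zZ|v w vw|v w z vw zZ].
- apply/subvP => _ /memv_imgP[_ /memv_imgP[c cC ->] ->].
  rewrite memv_cap memv_ker bnd_bnd eqxx andbT -(red_bnd phiP) memv_img //.
  exact: bnd_chains (fset_sub (f := XF) (u := v)) cC.
- pose z := sqrep _ _ y; have zZ : z \in cycles (XF v) q := sqrepP y.
  have := zZ; rewrite memv_cap => /andP[zC]; rewrite memv_ker => /eqP bz.
  have phiz : phi z \in red_cycles q v.
    by rewrite memv_cap memv_img // memv_ker -(red_bnd phiP) bz linear0 /=.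
  exists (phi z) => //; rewrite -[y]sqrepK -/z; apply/eqP; rewrite eq_sym -subr_eq0.
  rewrite -linearB sqclass_eq0 ?(red_homotopic phiP) // memvB //.
  by case: (red_cyclesW phiz).
- have [zE zC] := red_cyclesW zZ; rewrite sqclass_eq0 //.
  apply/idP/idP => [/memv_imgP[c cC zc]|].
    by rewrite -zE zc (red_bnd phiP) memv_img // memv_img.
  exact: subvP (limgS _ (C _ _)) _.
- by apply: capvS => //; apply: limgS; apply/chainsS/fset_mono.
- by have [_ zC] := red_cyclesW zZ; apply: homology_map_class => //; exact: fset_mono.
Qed.

Lemma red_image_drawn q (S : {set 'I_n}) v :
  (forall s, s \in XF v -> s \in Y -> cdim s = q ->
     exists2 j, j \in S & (U_(j) <= v)%MM && (s \in XF (v - U_(j))%MM)) ->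
  drawn (red_image q) S v.
Proof.
move=> H; apply: (subv_trans (red_cells phiP v q)); rewrite -limg_sum limgS //.
apply/span_subvP => _ /mapP[s + ->]; rewrite mem_filter mem_enum inE.
case/and3P=> /eqP sq sv sY; have [j jS /andP[jv sj]] := H s sv sY sq.
rewrite (bigD1 j) ?jS //=; apply: (subvP (addvSl _ _)).
by rewrite memv_span // map_f // mem_filter sq eqxx mem_enum.
Qed.

Lemma red_bounds_drawn q S v : drawn (red_image q.+1) S v -> drawn (red_bounds q) S v.
Proof. by move=> d; rewrite /drawn -limg_sum limgS. Qed.

(** Intersecting with the kernel of [bnd X] respects one inclusion but not sums, hence the single
    direction. Boundaries, as images, allow any set. *)
Lemma red_cycles_drawn q k v :
  drawn (red_image q) [set k] v -> drawn (red_cycles q) [set k] v.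
Proof.
rewrite !drawn1; case: ifP => _ d; first exact: capvS.
by move: d; rewrite !subv0 /red_cycles => /eqP ->; rewrite cap0v.
Qed.

Definition grades q : pred 'X_{1..n} :=
  [pred v | [exists s, [&& s \in Y, cdim s == q & ent XF s v]]].

Lemma grades_ent q s v : s \in Y -> cdim s = q -> ent XF s v -> grades q v.
Proof. by move=> sY sq es; apply/existsP; exists s; rewrite sY sq eqxx. Qed.

(** A cell present at v has an entrance grade g <= v; the gap forces g k < v k, so the cell is
    present at v - e_k. *)
Lemma gap_drawn q k u :
  (forall v, grades q v -> (v <= u)%MM -> (v k < u k)%N) ->
  forall v, (v <= u)%MM -> v k = u k -> drawn (red_image q) [set k] v.
Proof.
move=> gap v vu vk; apply: red_image_drawn => s sv sY sq; exists k; first by rewrite inE.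
have [g gv eg] := entP sv.
have gk : (g k < v k)%N by rewrite vk gap ?(grades_ent sY sq) ?(lepm_trans gv).
rewrite lep1mP -lt0n (leq_ltn_trans _ gk) //= (subsetP (fset_mono _ (lem_subU gv gk))) //.
by move: eg; rewrite /ent inE => /andP[].
Qed.

Lemma not_grade_drawn q u : ~~ grades q u -> drawn (red_image q) setT u.
Proof.
move=> ng; apply: red_image_drawn => s su sY sq.
have : ~~ ent XF s u by apply: contra ng; exact: grades_ent.
rewrite /ent inE su andbT negbK => /bigcupP[j _]; rewrite /prev_set.
by case: ifP => [jv sj|_]; [exists j; rewrite ?jv ?sj | rewrite inE].
Qed.

Lemma reduction_bounds (GG GR : nat -> 'X_{1..n} -> Prop) : (0 < n)%N ->
  (forall q v, grades q v -> GG q v) -> betti_bounds XF GG GR.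
Proof.
move=> n0 sGG q; have pr := red_presentation q.
have clG r u : lub_closure (grades r) u -> lub_closure (GG r) u.
  exact: lub_closureS (sGG r).
have clR u : lub_closure (GG q.+1) u -> lub_closure (fun v => GR q v \/ GG q.+1 v) u.
  by apply: lub_closureS => v; right.
have vanishing i u : vanish (std_resolution (ph_module XF q)) setT i u -> xi XF i q u = 0%N.
  exact: dim_tor_res.
have gapZ k u : (forall v, grades q v -> (v <= u)%MM -> (v k < u k)%N) ->
    forall v, (v <= u)%MM -> v k = u k -> drawn (red_cycles q) [set k] v.
  by move=> gap v vu vk; apply/red_cycles_drawn/(gap_drawn gap).
have gapB l u : (forall v, grades q.+1 v -> (v <= u)%MM -> (v l < u l)%N) ->
    forall v, (v <= u)%MM -> v l = u l -> drawn (red_bounds q) [set l] v.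
  by move=> gap v vu vk; apply/red_bounds_drawn/(gap_drawn gap).
split=> [u|u|u|u [i [_]]].
- case: (lub_closure_gap (grades q) u n0) => [/clG //|[k gap]] []; apply: vanishing.
  apply: (vanish_drawn0 pr); apply: (drawnS (subsetT [set k])).
  exact: (gapZ k u gap _ (lepm_refl u) erefl).
- case: (lub_closure_gap (grades q) u n0) => [/clG|[k gap]]; first by constructor 3.
  have [gu _|ngu] := boolP (grades q.+1 u); first by constructor 2; exact: sGG.
  case; apply: vanishing; apply: (vanish_drawn_pair pr (k := k)).
  - by rewrite inE.
  - exact: (gapZ k u gap).
  - exact/red_bounds_drawn/not_grade_drawn.
- case: (lub_closure_gap (grades q.+1) u n0) => [/clG/clR //|[l gap]] [].
  apply: vanishing; apply: (vanish_top pr (l := l)); exact: (gapB l u gap).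
case: (lub_closure_gap (grades q) u n0) => [/clG|[k gapk]]; first by right.
case: (lub_closure_gap (grades q.+1) u n0) => [/clG/clR|[l gapl]]; first by left.
case; apply: vanishing; apply: (vanish_all pr (k := k) (l := l)).
- exact: (gapZ k u gapk).
- exact: (gapB l u gapl).
Qed.

End Bounds.
End Reduction.

(** * Discrete Morse theory *)

Section Morse.
Variables (F : fieldType) (X : cell_complex F) (n : nat) (XF : filtration X n).
Variable V : {set X * X}.
Hypotheses (V_grad : discrete_gradient V) (V_cons : consistent XF V).
Implicit Types (f g : chain X) (s t : X) (u : 'X_{1..n}) (q : nat).

Lemma pair_facet s t : (s, t) \in V -> kappa t s != 0.
Proof. by case: V_grad => -[H _] _ /H. Qed.

Lemma pair_eq p p' s : p \in V -> p' \in V ->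
  s \in [set p.1; p.2] -> s \in [set p'.1; p'.2] -> p = p'.
Proof.
case: V_grad => -[_ H] _ pV p'V sp sp'; apply/eqP; apply: contraT => /eqP pp'.
by have /pred0P/(_ s) := H p p' pV p'V pp'; rewrite /= sp sp'.
Qed.

Lemma pair_inj2 s t t' : (s, t) \in V -> (s, t') \in V -> t = t'.
Proof. by move=> V1 V2; have [] := pair_eq V1 V2 (set21 s t) (set21 s t'). Qed.

Definition up : pred X := [pred s | [exists t, (s, t) \in V]].
Definition down : pred X := [pred t | [exists s, (s, t) \in V]].

Lemma up_down s : up s -> down s -> False.
Proof.
case/existsP => t V1 /existsP[r V2]; have := pair_facet V1.
have [_ ->] := pair_eq V1 V2 (set21 s t) (set22 r s).
by move/kappa_dim/n_Sn.
Qed.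

Lemma not_critical s : s \notin critical V -> up s \/ down s.
Proof.
rewrite inE negb_forall => /existsP[[a b]]; rewrite negb_imply => /andP[abV].
rewrite negb_and !negbK => /orP[] /eqP /= ->; [left | right]; apply/existsP.
  by exists b.
by exists a.
Qed.

Definition vpath_step : rel X :=
  fun s s' => [exists t, [&& (s, t) \in V, facet s' t & s' != s]].

Lemma vpath_acyclic s s' : vpath_step s s' -> ~~ connect vpath_step s' s.
Proof.
move=> ss'; apply/negP => /connectP[p pP sE]; case: V_grad => _; apply.
have cyc : path vpath_step s (s' :: p) by rewrite /= ss'.
pose c i := nth s (s :: s' :: p) i.
(* [d i] recovers the cell paired with [c i]; the default is not reached along the cycle. *)
pose d i := odflt s [pick t | [&& (c i, t) \in V, facet (c i.+1) t & c i.+1 != c i]].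
exists (size p).+1, c, d; split=> // [i ip|].
  have /existsP[t0 t0P] := pathP s cyc i ip; rewrite /d; case: pickP => [t|/(_ t0)].
    by case/and3P=> /= -> -> /eqP.
  by rewrite t0P.
by rewrite /c -[(size p).+1]/(size (s' :: p)) -last_nth.
Qed.

(** Acyclicity makes this number drop strictly along steps, so it serves as an induction measure. *)
Definition vpath_rank s := #|connect vpath_step s|.

Lemma vpath_rank_lt s s' : vpath_step s s' -> (vpath_rank s' < vpath_rank s)%N.
Proof.
move=> ss'; apply: proper_card; apply/properP; split.
  by apply/subsetP => r; apply: connect_trans; exact: connect1.
by exists s; [exact: connect0 | exact: vpath_acyclic].
Qed.

Lemma vpath_stepI s s' t : (s, t) \in V -> kappa t s' != 0 -> s' != s -> vpath_step s s'.
Proof. by move=> sV k0 ss'; apply/existsP; exists t; rewrite sV ss' andbT. Qed.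

(** The boundary from [down] to [up] cells is a matrix triangular for [vpath_rank] with nonzero
    diagonal; [delta] inverts it by back substitution. *)
Lemma up_inverse : exists delta : X -> chain X, forall s, up s ->
  [/\ forall t, delta s t != 0 -> down t,
      forall u, s \in XF u -> delta s \in chains (XF u) (cdim s).+1
    & forall s', up s' -> bnd X (delta s) s' = (s' == s)%:R].
Proof.
suff H m : exists delta : X -> chain X, forall s, up s -> (vpath_rank s < m)%N ->
  [/\ forall t, delta s t != 0 -> down t,
      forall u, s \in XF u -> delta s \in chains (XF u) (cdim s).+1
    & forall s', up s' -> bnd X (delta s) s' = (s' == s)%:R].
  have [delta dP] := H #|X|.+1; exists delta => s us; apply: dP => //.
  by rewrite ltnS max_card.
elim: m => [|m [d dP]]; first by exists (fun=> 0).
(* The corrections cancel the other [up] faces s' of t; their ranks are smaller, so [d s'] is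
   already correct. *)
exists (fun s => if [pick t | (s, t) \in V] is Some t then
  (kappa t s)^-1 *: (cell_vec t - \sum_(s' | up s' && (s' != s)) kappa t s' *: d s')
  else 0) => s us sm.
case: pickP => [t sV|no]; last by case/existsP: us => t; rewrite no.
have kts := pair_facet sV.
have dP' s' : up s' -> s' != s -> kappa t s' != 0 ->
  [/\ forall t, d s' t != 0 -> down t,
      forall u, s' \in XF u -> d s' \in chains (XF u) (cdim s').+1
    & forall s'', up s'' -> bnd X (d s') s'' = (s'' == s')%:R].
  move=> us' ss' k0; apply: dP => //; rewrite -ltnS; apply: leq_trans sm.
  by rewrite ltnS vpath_rank_lt // (vpath_stepI sV).
split=> [r|u su|s' us'].
- apply: contraNT => nd; rewrite !ffunE sum_ffunE.
  have -> : (r == t) = false.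
    by apply: contraNF nd => /eqP ->; apply/existsP; exists s.
  rewrite big1 ?subr0 ?scaler0 // => s' /andP[us' ss']; rewrite ffunE.
  have [->|k0] := eqVneq (kappa t s') 0; first by rewrite scale0r.
  have [H _ _] := dP' _ us' ss' k0.
  by have -> : d s' r = 0 by [apply/eqP; apply: contraNT nd => /H]; rewrite scaler0.
(* By consistency t enters with s, and every s' is a face of t. *)
- have tu : t \in XF u by apply/(V_cons sV u).
  rewrite memvZ // memvB ?memv_suml //.
    apply/mem_chains => r; rewrite ffunE; case: (r =P t) => [-> _|_]; last by rewrite eqxx.
    by split => //; exact: kappa_dim.
  move=> s' /andP[us' ss']; have [->|k0] := eqVneq (kappa t s') 0.
    by rewrite scale0r mem0v.
  have [_ H _] := dP' _ us' ss' k0; rewrite memvZ //.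
  have -> : cdim s = cdim s' by apply/succn_inj; rewrite -(kappa_dim kts) (kappa_dim k0).
  by apply: H; apply: (@fset_sub _ _ _ XF u) tu; exact: connect1.
rewrite linearZ linearB /= ffunE ffunE [X in _ *: (X + _)]bndE.
rewrite [X in _ *: (_ + X)]ffunE bnd_sumZ.
rewrite (bigD1 t) //= ffunE eqxx mul1r [X in _ + X + _]big1 ?addr0; last first.
  by move=> r rt; rewrite ffunE (negPf rt) mul0r.
have [->|ss'] := eqVneq s' s.
  rewrite big1 ?subr0 => [|s'' /andP[us'' ss'']]; first exact: mulVf.
  have [->|k0] := eqVneq (kappa t s'') 0; first by rewrite mul0r.
  by have [_ _ ->] := dP' _ us'' ss'' k0; rewrite // eq_sym (negPf ss'') mulr0.
rewrite (bigD1 s') ?us' //= big1 ?addr0 => [|s'' /andP[/andP[us'' ss''] s''s']]; last first.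
  have [->|k0] := eqVneq (kappa t s'') 0; first by rewrite mul0r.
  by have [_ _ ->] := dP' _ us'' ss'' k0; rewrite // eq_sym (negPf s''s') mulr0.
have [->|k0] := eqVneq (kappa t s') 0; first by rewrite mul0r subrr scaler0.
have [_ _ ->] := dP' _ us' ss' k0; rewrite // eqxx mulr1 subrr scaler0 //.
Qed.

Lemma down_bnd_inj f : (forall t, f t != 0 -> down t) ->
  (forall s, up s -> bnd X f s = 0) -> f = 0.
Proof.
move=> fD bf.
(* Induction runs from the highest rank down: any other t' in the support with face s is paired with
   an s' that steps to s, hence of larger rank. *)
suff H m s t : (s, t) \in V -> (#|X| < vpath_rank s + m)%N -> f t = 0.
  apply/ffunP => t; rewrite [RHS]ffunE; apply/eqP; apply: contraT => /[dup] ft /fD/existsP[s sV].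
  by rewrite (H #|X|.+1 s t) ?eqxx // -addSnnS addSn ltnS leq_addl in ft.
elim: m s t => [|m IHm] s t sV sm; first by rewrite addn0 ltnNge max_card in sm.
have us : up s by apply/existsP; exists t.
have := bf s us; rewrite bndE (bigD1 t) //= big1 => [|t' tt'].
  by move/eqP; rewrite addr0 mulf_eq0 (negPf (pair_facet sV)) orbF => /eqP.
have [->|k0] := eqVneq (kappa t' s) 0; first exact: mulr0.
suff -> : f t' = 0 by rewrite mul0r.
apply/eqP; apply: contraT => /[dup] ft' /fD/existsP[s' s'V].
have ss' : s != s' by apply: contraNneq tt' => E; rewrite -E in s'V; rewrite (pair_inj2 s'V sV).
move: ft'; rewrite (IHm s' t') ?eqxx //; apply: leq_trans sm _.
by rewrite addnS -addSn leq_add2r vpath_rank_lt // (vpath_stepI s'V).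
Qed.

Lemma up_homotopy : exists K : 'End(chain X),
  [/\ forall f t, K f t != 0 -> down t,
      forall f u q, f \in chains (XF u) q -> K f \in chains (XF u) q.+1,
      forall f s, up s -> bnd X (K f) s = f s
    & forall f, (forall s, up s -> f s = 0) -> K f = 0].
Proof.
have [d dP] := up_inverse.
pose Kf f : chain X := \sum_(s | up s) f s *: d s.
have Kf_lin : linear Kf.
  move=> a f g; rewrite /Kf scaler_sumr -big_split /=; apply: eq_bigr => s _.
  by rewrite !ffunE scalerDl scalerA.
pose KL := HB.pack_for {linear chain X -> chain X} Kf
  (GRing.isLinear.Build F _ _ _ Kf Kf_lin).
have KE f : linfun KL f = \sum_(s | up s) f s *: d s by rewrite lfunE.
exists (linfun KL); split=> [f t|f u q /mem_chains fC|f s us|f f0]; rewrite KE.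
- apply: contraNT => nd; rewrite sum_ffunE big1 // => s us; rewrite ffunE.
  have [H _ _] := dP s us.
  by have -> : d s t = 0 by [apply/eqP; apply: contraNT nd => /H]; rewrite scaler0.
- apply: memv_suml => s us; have [->|/fC[su <-]] := eqVneq (f s) 0.
    by rewrite scale0r mem0v.
  by have [_ H _] := dP s us; rewrite memvZ // H.
- rewrite bnd_sumZ (bigD1 s) //= big1 ?addr0 => [|s' /andP[us' ss']].
    by have [_ _ H] := dP s us; rewrite H // eqxx mulr1.
  have [_ _ H] := dP s' us'.
  by rewrite H // eq_sym (negPf ss') mulr0.
- by apply: big1 => s us; rewrite f0 // scale0r.
Qed.

Lemma morse_reduction : exists phi, reduction XF (critical V) phi.
Proof.
have [K [K_down K_chains K_up K_0]] := up_homotopy.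
pose phi : 'End(chain X) := (\1 - (bnd X \o K) - (K \o bnd X))%VF.
have phiE f : phi f = f - bnd X (K f) - K (bnd X f).
  by rewrite /phi !add_lfunE !opp_lfunE id_lfunE !comp_lfunE.
have phi_bnd f : phi (bnd X f) = bnd X (phi f).
  by rewrite !phiE bnd_bnd linear0 subr0 !linearB /= bnd_bnd subr0.
(* On [up] cells bnd (K f) equals f, and K (bnd f) is supported on [down] cells. *)
have phi_up f s : up s -> phi f s = 0.
  move=> us; rewrite phiE !ffunE K_up // subrr sub0r.
  apply/eqP; rewrite oppr_eq0; apply: contraT => /K_down ds.
  by case: (up_down us ds).
have phi_id f : (forall s, up s -> f s = 0) -> (forall s, up s -> bnd X f s = 0) ->
    phi f = f.
  by move=> f0 bf0; rewrite phiE !K_0 // linear0 !subr0.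
have phi_idem f : phi (phi f) = phi f.
  by apply: phi_id => s us; rewrite -?phi_bnd phi_up.
(* Here K f = 0, and f - K (bnd f) is supported on [down] cells with boundary zero on [up] cells, so
   injectivity applies. *)
have phi_down f : (forall t, f t != 0 -> down t) -> phi f = 0.
  move=> fD; have f0 s : up s -> f s = 0.
    by move=> us; apply/eqP; apply: contraT => /fD ds; case: (up_down us ds).
  rewrite phiE K_0 // linear0 subr0; apply: down_bnd_inj => [t|s us].
    apply: contraNT => nd; rewrite !ffunE.
    have -> : f t = 0 by apply/eqP; apply: contraNT nd => /fD.
    have -> : K (bnd X f) t = 0 by apply/eqP; apply: contraNT nd => /K_down.
    by rewrite subr0.
  by rewrite linearB !ffunE /= K_up // subrr.
have phi_chains u q f : f \in chains (XF u) q -> phi f \in chains (XF u) q.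
  have sX : subcomplex (XF u) := fset_sub (f := XF) (u := u).
  move=> fC; rewrite phiE memvB ?memvB //; first exact/bnd_chains/K_chains.
  case: q fC => [/bnd_chains0 ->|q fC]; first by rewrite linear0 mem0v.
  exact/K_chains/bnd_chains.
exists phi; split=> // [u q z|u q|u q].
- rewrite memv_cap memv_ker => /andP[zC /eqP bz].
  by rewrite phiE bz linear0 subr0 subKr memv_img // K_chains.
- by apply/subvP => _ /memv_imgP[f fC ->]; exact: phi_chains.
apply/subvP => _ /memv_imgP[f fC ->]; set g := phi f.
have /mem_chains gC : g \in chains (XF u) q by exact: phi_chains.
(* g is zero on [up] cells and [phi] kills its [down] part, so g = phi g = phi gc. *)
pose gc : chain X := [ffun s => if s \in critical V then g s else 0].
have gcC : gc \in chains (XF u :&: critical V) q.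
  apply/mem_chains => s; rewrite ffunE; case: ifP => [sM /gC[su sq]|_]; last by rewrite eqxx.
  by rewrite inE su.
suff -> : g = phi gc by rewrite memv_img.
rewrite -[LHS]phi_idem; apply/eqP; rewrite -subr_eq0 -linearB /=; apply/eqP.
apply: phi_down => t; rewrite !ffunE; case: ifPn => [_|/not_critical[ut|//]].
  by rewrite subrr eqxx.
by rewrite subr0 /g phi_up ?eqxx.
Qed.

End Morse.

Theorem proposition7p1 (F : fieldType) (n : nat) (n_ge1 : (1 <= n)%N)
    (X : cell_complex F) (XF : filtration X n)
    (XF_multi : multi_critical XF) (XF_exh : exhaustive XF) :
  betti_bounds XF (gradeG setT XF) (gradeR setT XF) /\
  (forall V : {set X * X},
     discrete_gradient V -> consistent XF V ->
     let M := critical V in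
     let MF := fun u => M :&: XF u in
     betti_bounds XF (gradeG M MF) (gradeR M MF)).
Proof.
split=> [|V Vg Vc M MF].
  have Vg : discrete_gradient (set0 : {set X * X}).
    split; first by split=> p; rewrite inE.
    by case=> r [s [t [r1 H _]]]; have [] := H 0%N r1; rewrite inE.
  have Vc : consistent XF (set0 : {set X * X}) by move=> p; rewrite inE.
  have [phi phiP] := morse_reduction Vg Vc.
  apply: (reduction_bounds phiP) => // q v /existsP[s /and3P[_ /eqP sq es]].
  by exists s; rewrite inE.
have [phi phiP] := morse_reduction Vg Vc.
apply: (reduction_bounds phiP) => // q v /existsP[s /and3P[sM /eqP sq es]].
by exists s; split=> //; rewrite entI.
Qed.
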